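(* Let $k$ be a field, and let $R$ be an associative unital $k$-algebra generated as a $k$-algebra by a finite dimensional $k$-subspace $V \subseteq R$ with $1 \in V$. Set $V^{-1} = 0$, $V^0 = k$ (that is, $k\cdot 1 \subseteq R$), and for $m \ge 1$ let $V^m$ be the $k$-linear span of all products of $m$ elements of $V$. Let $\operatorname{gr} R = \bigoplus_{i=0}^{\infty} V^i/V^{i-1}$ be the associated graded ring and let $\operatorname{gr} R^+ = \bigoplus_{i=1}^{\infty} V^i/V^{i-1}$, a graded ideal of $\operatorname{gr} R$. Suppose that $R$ is algebraic over $k$. Then the following conditions are equivalent: (i) $R$ is finite dimensional over $k$. (ii) $\operatorname{gr} R$ is finite dimensional over $k$. (iii) $\operatorname{gr} R^+$ is nilpotent, i.e. $(\operatorname{gr} R^+)^n = 0$ for some $n \ge 1$. (iv) $\operatorname{gr} R$ is right noetherian. (v) $\operatorname{gr} R$ has right Krull dimension. (vi) $\operatorname{gr} R$ satisfies a polynomial identity.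
   Context: $R$ is algebraic over $k$ if every element of $R$ is a root of some nonzero polynomial in one variable with coefficients in $k$. Multiplication in $\operatorname{gr} R$ is determined by $(a + V^{m-1})(b + V^{n-1}) = ab + V^{m+n-1} \in V^{m+n}/V^{m+n-1}$ for $a \in V^m$, $b \in V^n$, $m,n \ge 0$, extended bilinearly; $\operatorname{gr} R$ is thereby a graded $k$-algebra with degree $i$ component $V^i/V^{i-1}$. Right Krull dimension is meant in the sense of Gabriel and Rentschler (ordinal valued). For a right module $M$, set $\mathcal{K}(M) = -1$ if $M = 0$; inductively, for an ordinal $\alpha \ge 0$, $\mathcal{K}(M) = \alpha$ if $\mathcal{K}(M)$ is not $< \alpha$ and, in every descending chain $M \supseteq M_0 \supseteq M_1 \supseteq \cdots$ of submodules, for all but finitely many $i$ the factor $M_i/M_{i+1}$ has Krull dimension and $\mathcal{K}(M_i/M_{i+1}) < \alpha$. If no such ordinal exists, $M$ does not have Krull dimension. A ring $A$ has right Krull dimension if the right module $A_A$ has Krull dimension. A $k$-algebra $A$ satisfies a polynomial identity if there is a nonzero element $f(x_1,\dots,x_d)$ of a free associative algebra $k\langle x_1,\dots,x_d\rangle$ such that $f(a_1,\dots,a_d) = 0$ for all $a_1,\dots,a_d \in A$. *)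

(* Defs.v *)
From HB Require Import structures.
From mathcomp Require Import all_boot all_order all_algebra.
From mathcomp Require Import finmap.
From mathcomp.multinomials Require Import monalg.
From mathcomp Require Import boolp.

Set Implicit Arguments.
Unset Strict Implicit.
Unset Printing Implicit Defensive.

Import Order.TTheory GRing.Theory.
Local Open Scope ring_scope.
Local Open Scope quotient_scope.

Section Span.
Variables (K : pzRingType) (M : lmodType K).

Definition span (S : {pred M}) : {pred M} :=
  fun x => `[< exists (n : nat) (c : 'I_n -> K) (v : 'I_n -> M),
                 (forall i, v i \in S) /\ x = \sum_(i < n) c i *: v i >].

Lemma spanP (S : {pred M}) x :
  reflect (exists (n : nat) (c : 'I_n -> K) (v : 'I_n -> M),
             (forall i, v i \in S) /\ x = \sum_(i < n) c i *: v i)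
          (x \in span S).
Proof. exact: asboolP. Qed.

Lemma span0 (S : {pred M}) : 0 \in span S.
Proof.
by apply/spanP; exists 0, (fun=> 0), (fun=> 0); split=> [[]|]; rewrite ?big_ord0.
Qed.

Lemma spanD (S : {pred M}) x y :
  x \in span S -> y \in span S -> x + y \in span S.
Proof.
move=> /spanP[m [c [v [Sv ->]]]] /spanP[n [d [w [Sw ->]]]]; apply/spanP.
exists (m + n), (fun i => match split i with inl j => c j | inr j => d j end),
  (fun i => match split i with inl j => v j | inr j => w j end); split.
  by move=> i; case: (split i).
rewrite big_split_ord /=; congr (_ + _); apply: eq_bigr => i _.
  by rewrite (unsplitK (inl i)).
by rewrite (unsplitK (inr i)).
Qed.

Lemma spanZ (S : {pred M}) a x : x \in span S -> a *: x \in span S.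
Proof.
move=> /spanP[m [c [v [Sv ->]]]]; apply/spanP; exists m, (fun i => a * c i), v.
by split=> //; rewrite scaler_sumr; apply: eq_bigr => i _; rewrite scalerA.
Qed.

Lemma span_submod_closed (S : {pred M}) : submod_closed (span S).
Proof. by split=> [|a x y Sx Sy]; [exact: span0 | exact/spanD/Sy/spanZ]. Qed.

HB.instance Definition _ (S : {pred M}) :=
  GRing.isSubmodClosed.Build K M (span S) (span_submod_closed S).

Definition finite_dim (S : {pred M}) := exists s : seq M, S =i span [in s].

Definition finite_dimensional := finite_dim (@predT M).

Lemma sub_span (S : {pred M}) : {subset S <= span S}.
Proof.
move=> x Sx; apply/spanP; exists 1, (fun=> 1), (fun=> x); split=> //.
by rewrite big_ord1 scale1r.
Qed.

Lemma span_min (S : {pred M}) (N : submodClosed M) :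
  {subset S <= N} -> {subset span S <= N}.
Proof.
move=> SN x /spanP[n [c [v [Sv ->]]]].
by apply: rpred_sum => i _; apply/rpredZ/SN.
Qed.

End Span.

(* The factor module N / P of two submodules of M.  No inclusion is imposed:   *)
(* for P not contained in N this is N / (N :&: P).                            *)
Section Factor.
Variables (K : pzRingType) (M : lmodType K) (N P : submodClosed M).

Lemma submodN (S : submodClosed M) x : (- x \in S) = (x \in S).
Proof.
have oppS y : y \in S -> - y \in S by move=> Sy; rewrite -scaleN1r rpredZ.
by apply/idP/idP=> /oppS //; rewrite opprK.
Qed.

Definition submod := {x : M | x \in N}.
HB.instance Definition _ := SubChoice.on submod.
HB.instance Definition _ := [SubChoice_isSubLmodule of submod by <:].

Definition factor_rel (x y : submod) := val x - val y \in P.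

Lemma factor_rel_equiv : equiv_class_of factor_rel.
Proof.
rewrite /factor_rel; split=> [x|x y|y x z xy yz].
- by rewrite subrr rpred0.
- by rewrite -submodN opprB.
- by have := rpredD xy yz; rewrite addrA subrK.
Qed.

Canonical factor_equiv := EquivRelPack factor_rel_equiv.

Definition factor := {eq_quot factor_equiv}.
HB.instance Definition _ := Choice.on factor.
HB.instance Definition _ := EqQuotient.on factor.

Lemma factorP (x y : submod) :
  reflect (val x - val y \in P) (\pi_factor x == \pi_factor y).
Proof. by rewrite piE; apply: idP. Qed.

Definition factor_zero : factor := \pi_factor 0.
Definition factor_opp (q : factor) : factor := \pi_factor (- repr q).
Definition factor_add (q r : factor) : factor := \pi_factor (repr q + repr r).
Definition factor_scale (a : K) (q : factor) : factor :=
  \pi_factor (a *: repr q).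

Lemma factor_repr (x : submod) : val (repr (\pi_factor x)) - val x \in P.
Proof. by apply/factorP; rewrite reprK. Qed.

Lemma factor_oppE (x : submod) : factor_opp (\pi_factor x) = \pi_factor (- x).
Proof.
apply/eqP/factorP; rewrite !raddfN -opprD submodN.
exact: factor_repr.
Qed.

Lemma factor_addE (x y : submod) :
  factor_add (\pi_factor x) (\pi_factor y) = \pi_factor (x + y).
Proof.
by apply/eqP/factorP; rewrite !raddfD /= addrACA rpredD ?factor_repr.
Qed.

Lemma factor_scaleE a (x : submod) :
  factor_scale a (\pi_factor x) = \pi_factor (a *: x).
Proof.
by apply/eqP/factorP; rewrite !linearZ /= -scalerDr rpredZ ?factor_repr.
Qed.

Lemma factorW (Q : factor -> Prop) :
  (forall x, Q (\pi_factor x)) -> forall q, Q q.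
Proof. by move=> Qpi q; rewrite -[q]reprK. Qed.

Lemma factor_addA : associative factor_add.
Proof.
elim/factorW=> x; elim/factorW=> y; elim/factorW=> z.
by rewrite (factor_addE y z) (factor_addE x y) !(factor_addE _ _, addrA).
Qed.

Lemma factor_addC : commutative factor_add.
Proof.
by elim/factorW=> x; elim/factorW=> y; rewrite (factor_addE x y) addrC -factor_addE.
Qed.

Lemma factor_add0 : left_id factor_zero factor_add.
Proof. by elim/factorW=> x; rewrite (factor_addE 0 x) add0r. Qed.

Lemma factor_addN : left_inverse factor_zero factor_opp factor_add.
Proof.
by elim/factorW=> x; rewrite (factor_oppE x) (factor_addE (- x) x) addNr.
Qed.

HB.instance Definition _ := GRing.isZmodule.Build factor
  factor_addA factor_addC factor_add0 factor_addN.

Lemma factor_scaleA a b (q : factor) :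
  factor_scale a (factor_scale b q) = factor_scale (a * b) q.
Proof.
elim/factorW: q => x.
by rewrite (factor_scaleE b x) (factor_scaleE a (b *: x)) (factor_scaleE _ x) scalerA.
Qed.

Lemma factor_scale1 : left_id 1 factor_scale.
Proof. by elim/factorW=> x; rewrite (factor_scaleE 1 x) scale1r. Qed.

Lemma factor_scaleDr : right_distributive factor_scale +%R.
Proof.
move=> a; elim/factorW=> x; elim/factorW=> y.
rewrite [LHS](congr1 _ (factor_addE x y)) (factor_scaleE a (x + y)) scalerDr.
by rewrite (factor_scaleE a x) (factor_scaleE a y) [RHS](factor_addE _ _).
Qed.

Lemma factor_scaleDl (q : factor) : {morph factor_scale^~ q : a b / a + b}.
Proof.
elim/factorW: q => x a b; rewrite (factor_scaleE (a + b) x) scalerDl.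
by rewrite (factor_scaleE a x) (factor_scaleE b x) [RHS](factor_addE _ _).
Qed.

HB.instance Definition _ := GRing.Zmodule_isLmodule.Build K factor
  factor_scaleA factor_scale1 factor_scaleDr factor_scaleDl.

End Factor.

Section Graded.
Variables (k : fieldType) (R : algType k) (V : {pred R}).

(* products of m elements of S; the empty product 1 for m = 0 *)
Definition products (A : algType k) (S : {pred A}) (m : nat) : {pred A} :=
  fun x => `[< exists v : 'I_m -> A,
                 (forall i, v i \in S) /\ x = \prod_(i < m) v i >].

(* S^m.  For m = 0 this is the span k of 1. *)
Definition power (A : algType k) (S : {pred A}) (m : nat) : submodClosed A :=
  span (products S m).

(* V^{i-1}, with V^{-1} = 0. *)
Definition prev_power (i : nat) : submodClosed R :=
  if i is j.+1 then power V j else span pred0.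

Lemma productsM m n x y :
  x \in products V m -> y \in products V n -> x * y \in products V (m + n).
Proof.
move=> /asboolP[v [Vv ->]] /asboolP[w [Vw ->]]; apply/asboolP.
exists (fun i => match split i with inl j => v j | inr j => w j end); split.
  by move=> i; case: (split i).
rewrite big_split_ord /=; congr (_ * _); apply: eq_bigr => i _.
  by rewrite (unsplitK (inl i)).
by rewrite (unsplitK (inr i)).
Qed.

Lemma powerM m n x y :
  x \in power V m -> y \in power V n -> x * y \in power V (m + n).
Proof.
move=> /spanP[p [c [v [Vv ->]]]] /spanP[q [d [w [Vw ->]]]].
rewrite mulr_suml rpred_sum // => i _; rewrite mulr_sumr rpred_sum // => j _.
by rewrite -scalerAl -scalerAr !rpredZ // sub_span // productsM.
Qed.

Lemma power0_1 : 1 \in power V 0%N.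
Proof.
by apply/sub_span/asboolP; exists (fun=> 0); split=> [[]|]; rewrite ?big_ord0.
Qed.

Lemma prev_power0 x : (x \in prev_power 0%N) = (x == 0).
Proof.
apply/idP/eqP=> [/spanP[[|n] [c [v [Vv ->]]]]|->]; last exact: rpred0.
  by rewrite big_ord0.
by have := Vv ord0.
Qed.

Lemma prev_powerMl m n x y :
  x \in prev_power m -> y \in power V n -> x * y \in prev_power (m + n).
Proof.
case: m => [|m]; last exact: powerM.
by rewrite prev_power0 => /eqP-> _; rewrite mul0r rpred0.
Qed.

Lemma prev_powerMr m n x y :
  x \in power V m -> y \in prev_power n -> x * y \in prev_power (m + n).
Proof.
case: n => [|n] Vx; last by rewrite addnS; exact: powerM.
by rewrite prev_power0 => /eqP->; rewrite mulr0 rpred0.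
Qed.

(* V^i / V^{i-1} *)
Definition component (i : nat) := factor (power V i) (prev_power i).
HB.instance Definition _ i := GRing.Lmodule.on (component i).

Lemma mul_rep_subproof i j n (h : (i + j)%N = n)
    (x : submod (power V i)) (y : submod (power V j)) :
  val x * val y \in power V n.
Proof. by rewrite -h powerM //; [case: x | case: y]. Qed.

Definition mul_rep i j n (h : (i + j)%N = n)
    (x : submod (power V i)) (y : submod (power V j)) : submod (power V n) :=
  Sub (val x * val y) (mul_rep_subproof h x y).

(* (a + V^{i-1}) (b + V^{j-1}) = a b + V^{i+j-1}, computed on representatives; *)
(* mul_componentE shows that the choice of a and b does not matter.           *)
Definition mul_component i j n (h : (i + j)%N = n)
    (q : component i) (r : component j) : component n :=
  \pi_(factor (power V n) (prev_power n)) (mul_rep h (repr q) (repr r)).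

Lemma mul_componentE i j n (h : (i + j)%N = n)
    (x : submod (power V i)) (y : submod (power V j)) :
  mul_component h (\pi_(factor _ (prev_power i)) x)
                  (\pi_(factor _ (prev_power j)) y)
  = \pi_(factor _ (prev_power n)) (mul_rep h x y).
Proof.
apply/eqP/factorP.
set x' := repr (\pi_(factor _ (prev_power i)) x).
set y' := repr (\pi_(factor _ (prev_power j)) y).
change (val x' * val y' - val x * val y \in prev_power n).
have Px : val x' - val x \in prev_power i by exact: factor_repr.
have Py : val y' - val y \in prev_power j by exact: factor_repr.
rewrite -(subrK (val x * val y') (val x' * val y')) -addrA -mulrBl -mulrBr -h.
by apply: rpredD; [apply: prev_powerMl Px (valP y') | apply: prev_powerMr (valP x) Py].
Qed.

(* The direct sum of the components, as finitely supported families. *)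
Record gr := Gr {
  gr_comp :> forall i, component i;
  gr_finite : exists n, forall i, (n <= i)%N -> gr_comp i = 0 }.

HB.instance Definition _ := gen_eqMixin gr.
HB.instance Definition _ := gen_choiceMixin gr.

Lemma grP (x y : gr) : (forall i, x i = y i) -> x = y.
Proof.
case: x y => [x fx] [y fy] /= xy; have eqxy : x = y
  by exact/functional_extensionality_dep.
by case: y / eqxy fy xy => fy _; congr Gr; exact: Prop_irrelevance.
Qed.

(* the class in V^i / V^{i-1} of a representative a, for a in V^i *)
Definition cls i (a : R) : component i :=
  \pi_(factor (power V i) (prev_power i)) (insubd (0 : submod (power V i)) a).

Lemma clsE i (x : submod (power V i)) :
  cls i (val x) = \pi_(factor _ (prev_power i)) x.
Proof. by rewrite /cls valKd. Qed.

Lemma clsD i a b : a \in power V i -> b \in power V i ->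
  cls i (a + b) = cls i a + cls i b.
Proof.
move=> Va Vb; pose x : submod (power V i) := Sub a Va.
pose y : submod (power V i) := Sub b Vb.
rewrite -[a]/(val x) -[b]/(val y) -raddfD !clsE.
exact/esym/factor_addE.
Qed.

Lemma clsZ i c a : a \in power V i -> cls i (c *: a) = c *: cls i a.
Proof.
move=> Va; pose x : submod (power V i) := Sub a Va.
rewrite -[a]/(val x) -linearZ !clsE; exact/esym/factor_scaleE.
Qed.

Lemma cls0 i : cls i 0 = 0.
Proof. by rewrite -[0 in LHS](scale0r 0) clsZ ?rpred0 // scale0r. Qed.

Lemma cls_sum i n (F : 'I_n -> R) : (forall j, F j \in power V i) ->
  cls i (\sum_j F j) = \sum_j cls i (F j).
Proof.
move=> VF; elim: n F VF => [|n IHn] F VF; first by rewrite !big_ord0 cls0.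
by rewrite !big_ord_recl clsD ?IHn // rpred_sum.
Qed.

Lemma cls_eq0 i a : a \in power V i -> (cls i a == 0) = (a \in prev_power i).
Proof.
move=> Va; pose x : submod (power V i) := Sub a Va.
have <- : (val x - val (0 : submod (power V i)) \in prev_power i)
        = (a \in prev_power i) by rewrite subr0.
by rewrite -[a]/(val x) clsE; apply/factorP/idP.
Qed.

Lemma mul_cls i j n (h : (i + j)%N = n) a b :
  a \in power V i -> b \in power V j ->
  mul_component h (cls i a) (cls j b) = cls n (a * b).
Proof.
move=> Va Vb; pose x : submod (power V i) := Sub a Va.
pose y : submod (power V j) := Sub b Vb.
by rewrite -[a]/(val x) -[b]/(val y) !clsE mul_componentE -clsE.
Qed.

(* a is a family of representatives of the homogeneous components of x *)
Definition lifts (a : nat -> R) (x : forall i, component i) :=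
  forall i, a i \in power V i /\ cls i (a i) = x i.

Lemma liftsW (x : forall i, component i) : exists a, lifts a x.
Proof.
exists (fun i => val (repr (x i))) => i; split; first exact: valP.
by rewrite clsE reprK.
Qed.

Definition conv (a b : nat -> R) n := \sum_(i < n.+1) a i * b (n - i)%N.

Lemma conv_coef a b m n : (n <= m)%N ->
  conv a b n = (\poly_(i < m.+1) a i * \poly_(i < m.+1) b i)`_n.
Proof.
move=> nm; rewrite coefM; apply: eq_bigr => i _; rewrite !coef_poly.
by rewrite !ltnS (leq_trans (leq_subr _ _) nm) (leq_trans (leq_ord i) nm).
Qed.

Lemma convA a b c n : conv a (conv b c) n = conv (conv a b) c n.
Proof.
pose P (a : nat -> R) := \poly_(i < n.+1) a i.
transitivity ((P a * (P b * P c))`_n); last rewrite mulrA.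
  rewrite coefM; apply: eq_bigr => i _.
  by rewrite coef_poly ltn_ord (@conv_coef b c n) // leq_subr.
rewrite coefM; apply: eq_bigr => i _.
by rewrite coef_poly ltnS leq_subr (@conv_coef a b n) // leq_ord.
Qed.

Definition mul_family (x y : forall i, component i) n : component n :=
  \sum_(i < n.+1) mul_component (subnKC (leq_ord i)) (x i) (y (n - i)%N).

Lemma lifts_mul a b x y :
  lifts a x -> lifts b y -> lifts (conv a b) (mul_family x y).
Proof.
move=> ax by_ n.
have Vab (i : 'I_n.+1) : a i * b (n - i)%N \in power V n.
  rewrite -[X in power V X](subnKC (leq_ord i)).
  by apply: powerM; [case: (ax i) | case: (by_ (n - i)%N)].
split; first by apply: rpred_sum => i _; exact: Vab.
rewrite cls_sum //; apply: eq_bigr => i _.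
by have [? <-] := ax i; have [? <-] := by_ (n - i)%N; rewrite mul_cls.
Qed.

Lemma lifts_add a b x y : lifts a x -> lifts b y ->
  lifts (fun i => a i + b i) (fun i => x i + y i).
Proof.
by move=> ax by_ i; have [? <-] := ax i; have [? <-] := by_ i; rewrite rpredD ?clsD.
Qed.

Lemma lifts_scale c a x : lifts a x ->
  lifts (fun i => c *: a i) (fun i => c *: x i).
Proof. by move=> ax i; have [? <-] := ax i; rewrite rpredZ ?clsZ. Qed.

Lemma lifts_inj a b x y :
  lifts a x -> lifts b y -> a =1 b -> forall i, x i = y i.
Proof. by move=> ax by_ ab i; have [_ <-] := ax i; have [_ <-] := by_ i; rewrite ab. Qed.

Definition one_family i : component i := cls i (i == 0%N)%:R.

Lemma lifts_one : lifts (fun i => (i == 0%N)%:R) one_family.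
Proof. by case=> [|i]; rewrite ?power0_1 ?rpred0. Qed.

Lemma gr_zero_subproof :
  exists n, forall i, (n <= i)%N -> (0 : component i) = 0.
Proof. by exists 0. Qed.
Definition gr_zero := @Gr (fun=> 0) gr_zero_subproof.

Lemma gr_opp_subproof (x : gr) :
  exists n, forall i, (n <= i)%N -> - x i = 0.
Proof. by case: x => x [n xn]; exists n => i /xn /= ->; rewrite oppr0. Qed.
Definition gr_opp x := Gr (gr_opp_subproof x).

Lemma gr_add_subproof (x y : gr) :
  exists n, forall i, (n <= i)%N -> x i + y i = 0.
Proof.
case: x y => [x [m xm]] [y [n yn]]; exists (maxn m n) => i.
by rewrite geq_max => /andP[/xm /= -> /yn ->]; rewrite addr0.
Qed.
Definition gr_add x y := Gr (gr_add_subproof x y).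

Lemma gr_scale_subproof c (x : gr) :
  exists n, forall i, (n <= i)%N -> c *: x i = 0.
Proof. by case: x => x [n xn]; exists n => i /xn /= ->; rewrite scaler0. Qed.
Definition gr_scale c x := Gr (gr_scale_subproof c x).

Lemma gr_one_subproof :
  exists n, forall i, (n <= i)%N -> one_family i = 0.
Proof. by exists 1 => -[|i] // _; rewrite /one_family cls0. Qed.
Definition gr_one := Gr gr_one_subproof.

Lemma mul_component0 i j n (h : (i + j)%N = n) q r :
  q = 0 \/ r = 0 -> mul_component h q r = 0.
Proof.
have [x -> Vx] : exists2 a, q = cls i a & a \in power V i.
  by exists (val (repr q)); [rewrite clsE reprK | exact: valP].
have [y -> Vy] : exists2 a, r = cls j a & a \in power V j.
  by exists (val (repr r)); [rewrite clsE reprK | exact: valP].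
move=> qr; rewrite mul_cls //; apply/eqP; rewrite cls_eq0 -h; last exact: powerM.
case: qr => /eqP; rewrite cls_eq0 // => P0.
  exact: prev_powerMl P0 Vy.
exact: prev_powerMr Vx P0.
Qed.

Lemma gr_mul_subproof (x y : gr) :
  exists n, forall i, (n <= i)%N -> mul_family x y i = 0.
Proof.
case: x y => [x [m xm]] [y [n yn]]; exists (m + n)%N => i mni /=.
apply: big1 => j _; apply: mul_component0.
have [mj|jm] := leqP m j; [left; exact: xm | right; apply: yn].
by rewrite leq_subRL ?leq_ord // (leq_trans _ mni) // leq_add2r ltnW.
Qed.
Definition gr_mul x y := Gr (gr_mul_subproof x y).

Lemma gr_addA : associative gr_add.
Proof. by move=> x y z; apply: grP => i; exact: addrA. Qed.
Lemma gr_addC : commutative gr_add.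
Proof. by move=> x y; apply: grP => i; exact: addrC. Qed.
Lemma gr_add0 : left_id gr_zero gr_add.
Proof. by move=> x; apply: grP => i; exact: add0r. Qed.
Lemma gr_addN : left_inverse gr_zero gr_opp gr_add.
Proof. by move=> x; apply: grP => i; exact: addNr. Qed.

HB.instance Definition _ :=
  GRing.isZmodule.Build gr gr_addA gr_addC gr_add0 gr_addN.

Lemma gr_mulA : associative gr_mul.
Proof.
move=> x y z; apply: grP.
have [a ax] := liftsW x; have [b by_] := liftsW y; have [c cz] := liftsW z.
apply: (lifts_inj (lifts_mul ax (lifts_mul by_ cz))
                  (lifts_mul (lifts_mul ax by_) cz)).
exact: convA.
Qed.

Lemma gr_mul1 : left_id gr_one gr_mul.
Proof.
move=> x; apply: grP; have [a ax] := liftsW x.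
apply: (lifts_inj (lifts_mul lifts_one ax) ax) => n.
rewrite /conv big_ord_recl mul1r subn0 big1 ?addr0 // => i _.
by rewrite mul0r.
Qed.

Lemma gr_mulr1 : right_id gr_one gr_mul.
Proof.
move=> x; apply: grP; have [a ax] := liftsW x.
apply: (lifts_inj (lifts_mul ax lifts_one) ax) => n.
rewrite /conv big_ord_recr /= subnn mulr1 big1 ?add0r // => i _.
by rewrite subn_eq0 leqNgt ltn_ord mulr0.
Qed.

Lemma gr_mulDl : left_distributive gr_mul gr_add.
Proof.
move=> x y z; apply: grP.
have [a ax] := liftsW x; have [b by_] := liftsW y; have [c cz] := liftsW z.
apply: (lifts_inj (lifts_mul (lifts_add ax by_) cz)
  (lifts_add (lifts_mul ax cz) (lifts_mul by_ cz))) => n.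
by rewrite /conv -big_split; apply: eq_bigr => i _; exact: mulrDl.
Qed.

Lemma gr_mulDr : right_distributive gr_mul gr_add.
Proof.
move=> x y z; apply: grP.
have [a ax] := liftsW x; have [b by_] := liftsW y; have [c cz] := liftsW z.
apply: (lifts_inj (lifts_mul ax (lifts_add by_ cz))
  (lifts_add (lifts_mul ax by_) (lifts_mul ax cz))) => n.
by rewrite /conv -big_split; apply: eq_bigr => i _; exact: mulrDr.
Qed.

Lemma gr_1_neq0 : gr_one != gr_zero.
Proof.
apply/eqP=> /(congr1 (fun x : gr => x 0%N)) /= /eqP.
by rewrite /one_family cls_eq0 ?power0_1 // prev_power0 oner_eq0.
Qed.

HB.instance Definition _ := GRing.Zmodule_isNzRing.Build gr
  gr_mulA gr_mul1 gr_mulr1 gr_mulDl gr_mulDr gr_1_neq0.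

Lemma gr_scaleA a b x : gr_scale a (gr_scale b x) = gr_scale (a * b) x.
Proof. by apply: grP => i; exact: scalerA. Qed.
Lemma gr_scale1 : left_id 1 gr_scale.
Proof. by move=> x; apply: grP => i; exact: scale1r. Qed.
Lemma gr_scaleDr : right_distributive gr_scale +%R.
Proof. by move=> a x y; apply: grP => i; exact: scalerDr. Qed.
Lemma gr_scaleDl x : {morph gr_scale^~ x : a b / a + b}.
Proof. by move=> a b; apply: grP => i; exact: scalerDl. Qed.

HB.instance Definition _ := GRing.Zmodule_isLmodule.Build k gr
  gr_scaleA gr_scale1 gr_scaleDr gr_scaleDl.

Lemma gr_scaleAl (c : k) (x y : gr) : c *: (x * y) = (c *: x) * y.
Proof.
apply: grP; have [a ax] := liftsW x; have [b by_] := liftsW y.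
apply: (lifts_inj (lifts_scale c (lifts_mul ax by_))
                  (lifts_mul (lifts_scale c ax) by_)) => n.
by rewrite /conv scaler_sumr; apply: eq_bigr => i _; exact: scalerAl.
Qed.

Lemma gr_scaleAr (c : k) (x y : gr) : c *: (x * y) = x * (c *: y).
Proof.
apply: grP; have [a ax] := liftsW x; have [b by_] := liftsW y.
apply: (lifts_inj (lifts_scale c (lifts_mul ax by_))
                  (lifts_mul ax (lifts_scale c by_))) => n.
by rewrite /conv scaler_sumr; apply: eq_bigr => i _; exact: scalerAr.
Qed.

HB.instance Definition _ := GRing.Lmodule_isLalgebra.Build k gr gr_scaleAl.
HB.instance Definition _ := GRing.Lalgebra_isAlgebra.Build k gr gr_scaleAr.

(* the sum of the components of degree i >= 1 *)
Definition gr_plus : {pred gr} := fun x => x 0%N == 0.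

End Graded.

(* Right A-modules are left modules over the converse ring A^c; the right     *)
(* module A_A is (A^c)^o, whose scaling a *: x is the product x * a in A.     *)
Section Modules.
Variable K : pzRingType.

Definition noetherian (M : lmodType K) :=
  forall N : nat -> submodClosed M,
    (forall i, {subset N i <= N i.+1}) ->
    exists n, forall i, (n <= i)%N -> N i =i N n.

Section Krull.
Variables (d : Order.disp_t) (W : orderType d).
Hypothesis wfW : well_founded (fun b a : W => (b < a)%O).

(* [krull_below rec M] is K(M) < a, where [rec] gives K at the ordinals below *)
(* a, and where M = 0 is the case K(M) = -1.                                  *)
Definition krull_below (a : W) (rec : forall b : W, (b < a)%O -> lmodType K -> Prop)
    (M : lmodType K) : Prop :=
  (forall x : M, x = 0) \/ exists (b : W) (ba : (b < a)%O), rec b ba M.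

Definition krull_step (a : W) (rec : forall b : W, (b < a)%O -> lmodType K -> Prop)
    (M : lmodType K) : Prop :=
  ~ krull_below rec M /\
  forall N : nat -> submodClosed M,
    (forall i, {subset N i.+1 <= N i}) ->
    exists n, forall i, (n <= i)%N -> krull_below rec (factor (N i) (N i.+1)).

(* [krull_dim a M] is K(M) = a; an element a of the well-ordered set W stands *)
(* for the order type of the elements below it.                               *)
Definition krull_dim : W -> lmodType K -> Prop :=
  Fix wfW (fun=> lmodType K -> Prop) krull_step.

Lemma krull_dimE a M :
  krull_dim a M = krull_step (fun b (_ : (b < a)%O) => krull_dim b) M.
Proof.
rewrite /krull_dim Fix_eq // => x f g fg.
by congr krull_step; do 2!apply/functional_extensionality_dep=> ?; exact: fg.
Qed.

End Krull.

Definition has_krull_dim (M : lmodType K) : Prop :=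
  (forall x : M, x = 0) \/
  exists (d : Order.disp_t) (W : orderType d)
         (wfW : well_founded (fun b a : W => (b < a)%O)) (a : W),
    krull_dim wfW a M.

End Modules.

Definition right_noetherian (A : nzRingType) := noetherian (A^c)^o.

Definition has_right_krull_dim (A : nzRingType) := has_krull_dim (A^c)^o.

(* The free algebra on d variables is the algebra over k of the free monoid   *)
(* of words in 'I_d.                                                          *)
Definition satisfies_pi (k : fieldType) (A : algType k) :=
  exists (d : nat) (f : {malg k[{fmonom 'I_d}]}),
    f != 0 /\
    forall a : 'I_d -> A,
      mmap (in_alg A) (fun m : {fmonom 'I_d} => \prod_(i <- m) a i) f = 0.

Definition algebraic (k : fieldType) (A : algType k) :=
  forall a : A, exists2 p : {poly k}, p != 0 & root (map_poly (in_alg A) p) a.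

Definition generates (k : fieldType) (A : algType k) (S : {pred A}) :=
  forall B : subalgClosed A, {subset S <= B} -> forall a, a \in B.

(* Main.v *)
Require Import Defs.
From HB Require Import structures.
From mathcomp Require Import all_boot all_order all_algebra.
From mathcomp Require Import all_fingroup finmap.
From mathcomp.multinomials Require Import monalg.
From mathcomp Require Import zify boolp.
From mathcomp Require classical_sets.

(** All six conditions are equivalent to the filtration becoming stationary,
    V^n = V^(n-1) for some n.  As R is algebraic, the class of a in V^i / V^(i-1)
    with i >= 1 is nilpotent: a^n is a combination of lower powers of a.

    If gr R is right noetherian or has right Krull dimension, the graded right
    ideals have a deviation.  Suppose that no component vanishes.  Zorn's lemma
    yields a graded ideal P that is maximal among those containing no component,
    and P is prime.  Choose a graded right ideal Y > P in gr R+ such that for no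
    graded right ideals Z > P and P < X <= Y the interval [P, Z] embeds into
    [X, Y]; an infinite sequence of failures would contradict the deviation.
    For a homogeneous c in Y the kernel X of c : Y -> (c Y + P) / P is strictly
    larger than P since c is nilpotent, and [P, c Y + P] embeds into [X, Y];
    hence c Y <= P, so Y^2 <= P, against primality.

    If gr R satisfies a polynomial identity, it satisfies a multilinear one.
    Suppose that no component vanishes.  By König's lemma there is an infinite
    word in a spanning list of V none of whose factors is, in gr R, a combination of
    lexicographically smaller words of the same length.  If it is eventually
    periodic, it contains every power of a word u, which is impossible as u is
    nilpotent in gr R; otherwise it contains a product of as many decreasing
    blocks as the identity has variables, and the identity rewrites it as a
    combination of smaller words. *)

Set Implicit Arguments.
Unset Strict Implicit.
Unset Printing Implicit Defensive.

Import GRing.Theory.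
Local Open Scope ring_scope.
Local Open Scope quotient_scope.

(** * Deviation of intervals in a preorder *)

Section Deviation.
Variables (T : Type) (D : T -> Prop) (le : T -> T -> Prop).

Definition between lo hi x := [/\ D x, le lo x & le x hi].

Definition chain_between lo hi (f : nat -> T) :=
  forall i, between lo hi (f i) /\ le (f i.+1) (f i).

(* The interval [lo, hi] of the preorder D has a deviation.  The ordinal is    *)
(* replaced by the height of the inductive proof.                             *)
Inductive has_deviation (lo hi : T) : Prop :=
  HasDeviation of forall f, chain_between lo hi f ->
    exists n, forall i, (n <= i)%N ->
      le (f i) (f i.+1) \/ has_deviation (f i.+1) (f i).

(** The recursive occurrence sits under an existential and a disjunction, so the induction principle
    is built by hand. *)
Lemma has_deviation_ind' (Q : T -> T -> Prop) :
  (forall lo hi, (forall f, chain_between lo hi f ->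
     exists n, forall i, (n <= i)%N ->
       le (f i) (f i.+1) \/ Q (f i.+1) (f i)) -> Q lo hi) ->
  forall lo hi, has_deviation lo hi -> Q lo hi.
Proof.
move=> IH; fix rec 3 => lo hi [dev]; apply: IH => f /dev[n fn].
by exists n => i /fn[]; [left | right; exact: rec].
Qed.

Hypothesis le_trans : forall x y z, le x y -> le y z -> le x z.

(** An interval without deviation has a descending chain with a factor that again has none and whose
    lower end is strictly larger. Iterating, the lower ends ascend strictly for ever. *)
Lemma acc_has_deviation lo hi :
  (forall f : nat -> T, (forall i, D (f i) /\ le (f i) (f i.+1)) ->
     exists n, le (f n.+1) (f n)) ->
  D lo -> has_deviation lo hi.
Proof.
move=> acc Dlo; apply: contrapT => ndev.
pose bad (p : T * T) := D p.1 /\ ~ has_deviation p.1 p.2.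
have step (p : {p | bad p}) :
    {q : {p | bad p} | le (sval p).1 (sval q).1 /\ ~ le (sval q).1 (sval p).1}.
  apply/cid; case: p => -[l h] /= [Dl ndevl]; apply: contrapT => nstep.
  apply: ndevl; split=> f fP.
  (* A chain that drops to [l] stays there; if it never does, a factor without deviation would be
     the excluded next pair. *)
  have [[n fn]|gtl] := pselect (exists n, le (f n) l).
    exists n => i ni; left.
    have [[_ lf _] _] := fP i.+1; apply: le_trans lf.
    elim: i ni => [|i IHi]; first by rewrite leqn0 => /eqP<-.
    rewrite leq_eqVlt => /predU1P[<- //|/IHi].
    by apply: le_trans; have [_] := fP i.
  exists 0%N => i _; right; apply: contrapT => ndevi.
  have [[Df lf _] _] := fP i.+1; apply: nstep.
  exists (exist bad (f i.+1, f i) (conj Df ndevi)); split=> //= fl.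
  by apply: gtl; exists i.+1.
pose g := fix g i : {p | bad p} :=
  if i is j.+1 then sval (step (g j)) else exist bad (lo, hi) (conj Dlo ndev).
have [|n] := acc (fun i => (sval (g i)).1).
  move=> i; have [Di _] := svalP (g i); split=> //=.
  by have [] := svalP (step (g i)).
by rewrite /=; have [] := svalP (step (g n)).
Qed.

End Deviation.

(** * From Krull dimension to deviation *)

Section SpanClosed.
Variables (K : pzRingType) (M : lmodType K) (S : M -> Prop).
Hypotheses (S0 : S 0) (SD : forall x y, S x -> S y -> S (x + y))
  (SZ : forall a x, S x -> S (a *: x)).

Lemma span_closedP x : (x \in Defs.span [pred x | `[< S x >]]) <-> S x.
Proof.
split=> [/Defs.spanP[n [c [v [Sv ->]]]]|Sx]; last exact/Defs.sub_span/asboolP.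
by apply: big_ind => // i _; apply/SZ/asboolP/Sv.
Qed.

End SpanClosed.

Section KrullDeviation.
Variables (K : pzRingType) (T : Type) (D : T -> Prop) (le : T -> T -> Prop).
Hypothesis le_trans : forall x y z, le x y -> le y z -> le x z.

(** Induction on the ordinal: [phi] turns a chain of the interval into a chain of submodules whose
    late factors vanish or have smaller dimension, and each interval from [f i.+1] to [f i] embeds
    into the submodules of its factor. *)
Lemma krull_dim_has_deviation (d : Order.disp_t) (W : orderType d)
    (wfW : well_founded (fun b a : W => (b < a)%O)) (a : W) (M : lmodType K) :
  krull_dim wfW a M -> forall lo hi (phi : T -> submodClosed M),
  (forall x y, between D le lo hi x -> between D le lo hi y ->
     {subset phi x <= phi y} <-> le x y) ->
  has_deviation D le lo hi.
Proof.
elim/(well_founded_ind wfW): a M => a IHa M; rewrite krull_dimE => -[_ dcc].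
move=> lo hi phi phiP; split=> f fP.
have fbt i : between D le lo hi (f i) by have [] := fP i.
have phi_decr i : {subset phi (f i.+1) <= phi (f i)}.
  by apply/phiP => //; have [] := fP i.
have [n nP] := dcc (fun i => phi (f i)) phi_decr.
exists n => i /nP[fac0|[b [ba fac_b]]]; [left|right].
  apply/phiP => // x fx; pose x' : submod (phi (f i)) := Sub x fx.
  rewrite -[x](subr0 x).
  have /eqP/factorP := etrans (fac0 (\pi_(factor _ (phi (f i.+1))) x'))
    (esym (fac0 (\pi_(factor _ (phi (f i.+1))) 0))).
  by [].
(* The new embedding sends X to the image of [phi X]; it reflects the order because every [phi X]
   contains the kernel [phi (f i.+1)]. *)
pose F := factor (phi (f i)) (phi (f i.+1)).
pose im X (q : F) := exists2 x : submod (phi (f i)), q = \pi_F x & val x \in phi X.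
have imP X (q : F) : (q \in Defs.span [pred q | `[< im X q >]]) <-> im X q.
  apply: span_closedP => [|x y|c x].
  - by exists 0; rewrite ?rpred0.
  - move=> [u -> Xu] [v -> Xv]; exists (u + v); rewrite ?rpredD //.
    exact: factor_addE.
  - move=> [u -> Xu]; exists (c *: u); rewrite ?rpredZ //; exact: factor_scaleE.
apply: (IHa _ ba _ fac_b _ _ (fun X => Defs.span [pred q | `[< im X q >]])).
move=> X Y [DX fX Xf] [DY fY Yf].
have bt Z : D Z -> le (f i.+1) Z -> le Z (f i) -> between D le lo hi Z.
  move=> DZ fZ Zf; have [_ lf _] := fbt i.+1; have [_ _ fh] := fbt i.
  by split; [|exact: le_trans fZ|exact: le_trans fh].
have phif Z : D Z -> le (f i.+1) Z -> le Z (f i) -> {subset phi (f i.+1) <= phi Z}.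
  by move=> DZ fZ Zf; apply/phiP => //; exact: bt.
have fphi Z : D Z -> le (f i.+1) Z -> le Z (f i) -> {subset phi Z <= phi (f i)}.
  by move=> DZ fZ Zf; apply/phiP => //; exact: bt.
rewrite -phiP; [|exact: bt|exact: bt]; split=> [sub x Xx|sub q].
  pose x' : submod (phi (f i)) := Sub x (fphi X DX fX Xf x Xx).
  have /imP[y /eqP/factorP xy Yy] : \pi_F x' \in Defs.span [pred q | `[< im Y q >]].
    by apply/sub/imP; exists x'.
  rewrite -[x](subrK (val y)); apply: rpredD => //.
  exact: phif xy.
by move=> /imP[x -> Xx]; apply/imP; exists x => //; apply: sub.
Qed.

End KrullDeviation.

Definition incl (T : Type) (X Y : T -> Prop) := forall x, X x -> Y x.

Lemma incl_trans (T : Type) (X Y Z : T -> Prop) :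
  incl X Y -> incl Y Z -> incl X Z.
Proof. by move=> XY YZ x /XY/YZ. Qed.

Definition right_ideal (A : nzRingType) (I : A -> Prop) :=
  [/\ I 0, forall x y, I x -> I y -> I (x + y) & forall x a, I x -> I (x * a)].

Section RightIdealDeviation.
Variables (A : nzRingType) (D : (A -> Prop) -> Prop).
Hypothesis D_ideal : forall I, D I -> right_ideal I.

Let span_of (I : A -> Prop) : submodClosed (A^c)^o :=
  @Defs.span _ (A^c)^o [pred x | `[< I x >]].

Let span_ofP I x : D I -> (x \in span_of I) <-> I x.
Proof.
by case/D_ideal=> I0 ID IM; apply: (@span_closedP _ (A^c)^o) => // a y; apply: IM.
Qed.

Let span_of_sub I J : D I -> D J ->
  {subset span_of I <= span_of J} <-> incl I J.
Proof.
by move=> DI DJ; split=> sub x; [move=> Ix; apply/span_ofP/sub/span_ofP|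
  move=> /span_ofP Ix; apply/span_ofP/sub/Ix].
Qed.

Lemma right_noetherian_has_deviation lo hi :
  right_noetherian A -> D lo -> has_deviation D (@incl A) lo hi.
Proof.
move=> noe; apply: acc_has_deviation; first exact: incl_trans.
move=> f fP; have fD i : D (f i) by have [] := fP i.
have [|n fn] := noe (span_of \o f).
  by move=> i; apply/span_of_sub => //; have [] := fP i.
exists n; apply/span_of_sub => // x; rewrite -[span_of (f n.+1)]/((span_of \o f) n.+1).
by rewrite fn.
Qed.

Lemma right_krull_has_deviation lo hi :
  has_right_krull_dim A -> D lo -> D hi -> has_deviation D (@incl A) lo hi.
Proof.
move=> [A0|[d [W [wfW [a Ka]]]]] Dlo Dhi.
  by have /eqP := A0 (1 : A); rewrite oner_eq0.
apply: (krull_dim_has_deviation (@incl_trans A) Ka (phi := span_of)).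
by move=> X Y [DX _ _] [DY _ _]; exact: span_of_sub.
Qed.

End RightIdealDeviation.

(** * Graded rings with nilpotent homogeneous elements *)

Section Graded.
(** The grading is encoded by projections of A into itself, which keeps all degrees in one type.
    [proj_gen] says that A_i A_j spans A_(i+j) additively, [proj_fg] that each component generates a
    finitely generated right ideal. *)
Variables (A : nzRingType) (proj : nat -> A -> A).
Hypotheses
  (projD : forall i, {morph proj i : x y / x + y})
  (proj_proj : forall i j x, proj j (proj i x) = if i == j then proj i x else 0)
  (proj_sum : forall x, exists n, x = \sum_(i < n) proj i x)
  (projM : forall i j x y, proj (i + j) (proj i x * proj j y) = proj i x * proj j y)
  (proj0_unit : forall x, proj 0 x <> 0 -> exists u, proj 0 x * u = 1)
  (proj_gen : forall i j (S : A -> Prop), S 0 -> (forall x y, S x -> S y -> S (x + y)) ->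
     (forall x y, S (proj i x * proj j y)) -> forall z, S (proj (i + j) z))
  (proj_fg : forall i, exists s : seq A, forall I : A -> Prop, right_ideal I ->
     (forall x, x \in s -> I (proj i x)) -> forall x, I (proj i x))
  (proj_nil : forall i x, (0 < i)%N -> exists n, proj i x ^+ n = 0).

Lemma proj_zero i : proj i 0 = 0.
Proof. by apply: (@addIr _ (proj i 0)); rewrite -projD !add0r. Qed.

Lemma proj_big i n (F : 'I_n -> A) : proj i (\sum_j F j) = \sum_j proj i (F j).
Proof. by apply: (big_morph _ (projD i) (proj_zero i)). Qed.

Lemma projMl i j x y : proj (i + j) (proj i x * y) = proj i x * proj j y.
Proof.
have [m e] := proj_sum y; rewrite [in LHS]e [in RHS]e mulr_sumr !proj_big mulr_sumr.
apply: eq_bigr => l _; rewrite -projM !proj_proj eqn_add2l.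
by case: eqP => // _; rewrite mulr0.
Qed.

Lemma projMr i j x y : proj (i + j) (x * proj j y) = proj i x * proj j y.
Proof.
have [m e] := proj_sum x; rewrite [in LHS]e [in RHS]e mulr_suml !proj_big mulr_suml.
apply: eq_bigr => l _; rewrite -projM !proj_proj eqn_add2r.
by case: eqP => // _; rewrite mul0r.
Qed.

Lemma projMl_lt i j x y : (j < i)%N -> proj j (proj i x * y) = 0.
Proof.
move=> ji; have [m ->] := proj_sum y; rewrite mulr_sumr proj_big big1 // => l _.
by rewrite -projM proj_proj; case: eqP => // e; rewrite -e ltnNge leq_addr in ji.
Qed.

Definition homogeneous_sub (X : A -> Prop) := forall i x, X x -> X (proj i x).

Definition contains_degree (X : A -> Prop) := exists n, forall x, X (proj n x).

Lemma right_ideal_big (X : A -> Prop) n (F : 'I_n -> A) : right_ideal X ->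
  (forall i, X (F i)) -> X (\sum_i F i).
Proof. by case=> X0 XD _ XF; apply: big_ind => // x y; exact: XD. Qed.

Lemma right_idealB (X : A -> Prop) x y : right_ideal X -> X x -> X y -> X (x - y).
Proof.
by case=> _ XD XM Xx Xy; apply: XD => //; rewrite -mulrN1; exact: XM.
Qed.

Definition graded_ideal (X : A -> Prop) :=
  [/\ right_ideal X, forall a x, X x -> X (a * x) & homogeneous_sub X].

(* Membership of 0 is left out so that the empty set is allowed, as           *)
(* Zorn_bigcup requires.                                                      *)
Let small_ideal (X : A -> Prop) :=
  [/\ forall x y, X x -> X y -> X (x + y),
      forall x a b, X x -> X (a * x * b),
      homogeneous_sub X & forall n, exists x, ~ X (proj n x)].

Lemma exists_maximal_graded_ideal : (forall n, exists x, proj n x <> 0) ->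
  exists P : A -> Prop, [/\ graded_ideal P, ~ contains_degree P &
    forall X, graded_ideal X -> incl P X -> ~ incl X P -> contains_degree X].
Proof.
move=> Ainf; have [|P [[PD PM Pproj Pprop] Pmax]] :=
    @classical_sets.Zorn_bigcup A small_ideal.
  move=> F Fsmall Ftot; split.
  - move=> x y [X FX Xx] [Y FY Yy].
    have [XY|YX] := Ftot X Y FX FY; [exists Y|exists X] => //.
      by have [YD _ _ _] := Fsmall Y FY; apply: YD => //; exact: XY.
    by have [XD _ _ _] := Fsmall X FX; apply: XD => //; exact: YX.
  - by move=> x a b [X FX Xx]; exists X => //; have [_ XM _ _] := Fsmall X FX; exact: XM.
  - by move=> i x [X FX Xx]; exists X => //; have [_ _ Xp _] := Fsmall X FX; exact: Xp.
  move=> n; apply: contrapT => nex.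
  have {}nex x : exists2 X, F X & X (proj n x).
    by apply: contrapT => nX; apply: nex; exists x => -[X FX Xx]; apply: nX; exists X.
  have [s sgen] := proj_fg n.
  (* Finitely many elements decide whether degree n is contained, and they already lie in one member
     of the chain. *)
  have [X FX [X0 Xs]] : exists2 X, F X & X 0 /\ forall x, x \in s -> X (proj n x).
    elim: s {sgen} => [|x s [X FX [X0 Xs]]].
      by have [X FX] := nex 0; rewrite proj_zero => X0; exists X.
    have [Y FY Yx] := nex x; have [XY|YX] := Ftot X Y FX FY.
      exists Y => //; split=> [|z]; first exact: XY.
      by rewrite inE => /predU1P[->|/Xs /XY].
    exists X => //; split=> // z.
    by rewrite inE => /predU1P[->|/Xs //]; exact: YX.
  have [XD XM _ Xn] := Fsmall X FX.
  have [x []] := Xn n; apply: sgen => //; split=> // y a Xy.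
  by rewrite -[y]mul1r; exact: XM.
(* An empty maximal set would lie strictly below the zero ideal, which contains no component. *)
have P0 : P 0.
  apply: contrapT => nP0; apply: (Pmax (fun x => x = 0)).
    have nP x : ~ P x.
      by move=> Px; apply: nP0; have := PM x 0 1 Px; rewrite !mul0r.
    by split=> [x /nP//|/(_ 0 erefl)].
  split=> [x y -> ->|x a b ->|i x ->|//].
  - exact: addr0.
  - by rewrite mulr0 mul0r.
  - exact: proj_zero.
have Pideal : graded_ideal P.
  split=> //; first by split=> // x a Px; rewrite -[x]mul1r; exact: PM.
  by move=> a x Px; rewrite -[a * x]mulr1; exact: PM.
exists P; split=> //; first by case=> n nP; have [x] := Pprop n; apply.
move=> X [[X0 XD XM] XMl Xp] PX nXP; apply: contrapT => nX.
apply: (Pmax X); first by split.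
split=> // [x a b Xx|n]; first exact/XM/XMl.
by apply: contrapT => nx; apply: nX; exists n => x; apply: contrapT => ?; apply: nx; exists x.
Qed.
Section Maximal.
Variable P : A -> Prop.
Hypotheses (P_ideal : graded_ideal P) (P_small : ~ contains_degree P)
  (P_max : forall X, graded_ideal X -> incl P X -> ~ incl X P -> contains_degree X).

(** Without a part of degree 0, all homogeneous elements of a member are nilpotent. *)
Let D (X : A -> Prop) :=
  [/\ right_ideal X, homogeneous_sub X, incl P X & forall x, X x -> proj 0 x = 0].

(** An order embedding of the interval from P to Y; its lower end is implicit, as all members of [D]
    contain P. *)
Let embeds Y lo hi := exists phi : (A -> Prop) -> A -> Prop,
  (forall X, D X -> incl X Y -> between D (@incl A) lo hi (phi X)) /\
  (forall X1 X2, D X1 -> D X2 -> incl X1 Y -> incl X2 Y ->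
     incl (phi X1) (phi X2) <-> incl X1 X2).

Lemma maximal_proj0 x : P x -> proj 0 x = 0.
Proof.
move=> Px; apply: contrapT => /proj0_unit[u xu]; apply: P_small; exists 0%N => y.
have [[_ _ PM] _ Pp] := P_ideal.
by rewrite -[proj 0 y]mul1r -xu -mulrA; apply: PM; exact: Pp.
Qed.

Lemma D_P : D P.
Proof. by have [? ? ?] := P_ideal; split=> //; exact: maximal_proj0. Qed.

(** Two annihilators modulo P are formed in turn. Each is a graded ideal containing P and Y, so by
    maximality it contains a component; the product of the two components spans a component inside
    P. *)
Lemma maximal_prime (Y : A -> Prop) : D Y ->
  (forall x y, Y x -> Y y -> P (x * y)) -> incl Y P.
Proof.
move=> [[Y0 YD YM] Yp PY _] YY; apply: contrapT => nYP.
have [[P0 PD PM] PMl Pp] := P_ideal.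
have [n Yn] : contains_degree (fun a => forall y, Y y -> P (y * a)).
  apply: P_max.
  - split=> [|a x|i x] /=.
    + split=> [y|a b Pa Pb y Yy|a b Pa y Yy].
      * by rewrite mulr0.
      * by rewrite mulrDr; apply: PD; [exact: Pa|exact: Pb].
      * by rewrite mulrA; apply/PM/Pa.
    + by move=> Px y Yy; rewrite mulrA; apply/Px/YM.
    + move=> Px y Yy; have [m ->] := proj_sum y; rewrite mulr_suml.
      apply: right_ideal_big => // j; rewrite -projMl; exact/Pp/Px/Yp.
  - by move=> x Px y _; exact: PMl.
  - by move=> sub; apply: nYP => y Yy; apply: sub => z Yz; exact: YY.
(* The middle factor [r] makes this set closed under multiplication on the right. *)
have [m Am] : contains_degree (fun b => forall r a, P (b * r * proj n a)).
  apply: P_max.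
  - split=> [|a x|i x] /=.
    + split=> [r a|b c Pb Pc r a|b c Pb r a].
      * by rewrite !mul0r.
      * by rewrite !mulrDl; apply: PD; [exact: Pb|exact: Pc].
      * by rewrite -(mulrA b); exact: Pb.
    + by move=> Px r b; rewrite -!mulrA; apply: PMl; rewrite mulrA; exact: Px.
    + move=> Px r a; have [l ->] := proj_sum r; rewrite mulr_sumr mulr_suml.
      apply: right_ideal_big => // j; rewrite -mulrA -projM -projMr projM mulrA.
      exact/Pp/Px.
  - by move=> x Px r a; exact/PM/PM.
  - move=> sub; apply: nYP => y Yy; apply: sub => r a; apply: Yn; exact: YM.
apply: P_small; exists (m + n)%N; apply: proj_gen => // x y.
by have := Am x 1 y; rewrite mulr1.
Qed.

(* Left multiplication by a homogeneous c in Y induces                        *)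
(* Y / ker = (c Y + P) / P with ker <> P, as c is nilpotent.                  *)
Lemma critical_square_zero (Y : A -> Prop) : D Y ->
  (forall X Z, D X -> incl X Y -> ~ incl X P -> D Z -> ~ incl Z P -> ~ embeds Z X Y) ->
  forall x y, Y x -> Y y -> P (x * y).
Proof.
move=> DY crit; have [[Y0 YD YM] Yp PY Yplus] := DY.
have YI : right_ideal Y by [].
have [PI PMl Pp] := P_ideal; have [P0 PD PM] := PI.
suff homog i c : Y (proj i c) -> forall y, Y y -> P (proj i c * y).
  move=> x y Yx Yy; have [m ->] := proj_sum x; rewrite mulr_suml.
  by apply: right_ideal_big => // i; apply/homog => //; exact: Yp.
move=> Yc; set c' := proj i c in Yc *; apply: contrapT => /existsNP[y0 ncy0].
have {ncy0} [Yy0 ncy0] : Y y0 /\ ~ P (c' * y0) by apply/not_implyP.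
have i_gt0 : (0 < i)%N.
  rewrite lt0n; apply/eqP=> i0; apply: ncy0.
  have := Yplus _ Yc; rewrite /c' i0 proj_proj eqxx => ->; rewrite mul0r; exact: P0.
pose psi (U : A -> Prop) x := Y x /\ U (c' * x).
have Dpsi U : D U -> D (psi U).
  move=> [[U0 UD UM] Up PU _]; split.
  - split=> [|x y [? ?] [? ?]|x a [? ?]]; first by rewrite /psi mulr0.
      by split; [exact: YD|rewrite mulrDr; exact: UD].
    by split; [exact: YM|rewrite mulrA; exact: UM].
  - by move=> j x [? ?]; split; [exact: Yp|rewrite -projMl; exact: Up].
  - by move=> x Px; split; [exact: PY|exact/PU/PMl].
  - by move=> x [? _]; exact: Yplus.
pose Z z := exists x p, [/\ Y x, P p & z = c' * x + p].
have DZ : D Z.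
  split.
  - split; first by exists 0, 0; rewrite mulr0 addr0.
    + move=> _ _ [x [p [Yx Pp' ->]]] [y [q [Yy Pq ->]]].
      exists (x + y), (p + q); rewrite mulrDr addrACA.
      by split=> //; [exact: YD|exact: PD].
    + move=> _ a [x [p [Yx Pp' ->]]]; exists (x * a), (p * a); rewrite mulrDl mulrA.
      by split=> //; [exact: YM|exact: PM].
  - move=> j _ [x [p [Yx Pp' ->]]]; rewrite projD.
    have [ij|ji] := leqP i j.
      exists (proj (j - i) x), (proj j p); rewrite -projMl subnKC //.
      by split=> //; [exact: Yp|exact: Pp].
    exists 0, (proj j p); rewrite projMl_lt // mulr0; split=> //; exact: Pp.
  - by move=> p Pp'; exists 0, p; rewrite mulr0 add0r.
  - move=> _ [x [p [Yx Pp' ->]]]; rewrite projD (maximal_proj0 Pp') addr0.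
    by apply: Yplus; exact: YM.
apply: (crit (psi P) Z _ _ _ DZ).
- by apply: Dpsi; exact: D_P.
- by move=> x [].
(* If the kernel were inside P, factors [c'] could be cancelled modulo P one at a time, starting
   from [c' ^+ n = 0]. *)
- move=> sub; apply: ncy0; have [n cn] := proj_nil c i_gt0.
  suff cPn j : P (c' ^+ j * (c' * y0)) -> P (c' * y0).
    by apply: (cPn n); rewrite cn mul0r.
  elim: j => [|j IHj]; first by rewrite expr0 mul1r.
  rewrite exprS -mulrA => Pcj; apply/IHj/sub; split=> //.
  case: j {IHj Pcj} => [|j]; first by rewrite expr0 mul1r; exact: YM.
  by rewrite exprS -mulrA; exact: YM.
- move=> sub; apply: ncy0; apply: sub; by exists y0, 0; split=> //; rewrite addr0.
(* Taking preimages is the embedding: U between P and Z is recovered as c' (psi U) + P. *)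
exists psi; split=> [U DU UZ|U1 U2 DU1 DU2 U1Z U2Z].
  have [_ _ PU _] := DU; split; first exact: Dpsi.
    by move=> x [Yx Px]; split=> //; exact: PU.
  by move=> x [].
split=> [sub u Uu|sub x [Yx Ux]]; last by split=> //; exact: sub.
have [x [p [Yx Pp' e]]] := U1Z u Uu.
have [[_ U2D _] _ PU2 _] := DU2; have [U1I _ PU1 _] := DU1.
rewrite e; apply: U2D; last exact: PU2.
have [|//] := sub x; split=> //.
by rewrite -[_ * _](addrK p) -e; apply: right_idealB => //; exact: PU1.
Qed.

(** Induction on the deviation. A critical Y' inside Y is excluded by primality. Without one, Y
    starts a descending chain each of whose steps contains a copy of some [P, Z] with Z not inside
    P, and [phi] carries a late step to a factor where the induction hypothesis applies. *)
Lemma no_embedding lo hi : has_deviation D (@incl A) lo hi ->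
  forall Y, D Y -> ~ incl Y P -> ~ embeds Y lo hi.
Proof.
elim/has_deviation_ind' => {}lo {}hi IH Y DY nYP [phi [phi_bt phiP]].
pose S X := [/\ D X, incl X Y & ~ incl X P].
have [[Y' [DY' Y'Y nY'P] crit]|ncrit] := pselect (exists2 Y', S Y' &
    forall X Z, D X -> incl X Y' -> ~ incl X P -> D Z -> ~ incl Z P -> ~ embeds Z X Y').
  by apply: nY'P; apply: maximal_prime => //; exact: critical_square_zero.
have step (X : {X | S X}) : {X' : {X | S X} | incl (sval X') (sval X) /\
    exists Z, [/\ D Z, ~ incl Z P & embeds Z (sval X') (sval X)]}.
  apply/cid; case: X => X SX /=; apply: contrapT => nstep; apply: ncrit.
  exists X => // X' Z DX' X'X nX'P DZ nZP emb; apply: nstep.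
  have [_ XY _] := SX.
  have SX' : S X' by split=> //; exact: incl_trans X'X XY.
  by exists (exist _ X' SX'); split=> //; exists Z.
pose g := fix g i : {X | S X} :=
  if i is j.+1 then sval (step (g j))
  else exist _ Y (And3 DY (fun x => id) nYP).
have gS i : S (sval (g i)) := svalP (g i).
have gdecr i : incl (sval (g i.+1)) (sval (g i)).
  by have [] := svalP (step (g i)).
have [|n nP] := IH (fun i => phi (sval (g i))).
  move=> i; have [Dg gY _] := gS i; have [Dg1 gY1 _] := gS i.+1.
  by split; [exact: phi_bt|apply/(phiP _ _ Dg1 Dg gY1 gY)].
have [Dg gY _] := gS n; have [Dg1 gY1 _] := gS n.+1.
have [_ [Z [DZ nZP [psi [psi_bt psiP]]]]] := svalP (step (g n)).
(* If the factor is trivial, the step collapses, and the copy of [P, Z] in it forces Z into P. *)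
have [/(phiP _ _ Dg Dg1 gY gY1) gg|IHn] := nP n (leqnn n).
  apply: nZP; have [_ _ PZ _] := DZ; have idZ : incl Z Z by move=> x.
  apply/(psiP Z P DZ D_P idZ PZ).
  have [_ _ Zg] := psi_bt Z DZ idZ; have [_ gP _] := psi_bt P D_P PZ.
  by apply: incl_trans Zg _; apply: incl_trans gg gP.
apply: (IHn Z DZ nZP); exists (phi \o psi); split=> [X DX XZ|X1 X2 DX1 DX2 X1Z X2Z] /=.
  have [DpX gX Xg] := psi_bt X DX XZ.
  have pXY : incl (psi X) Y by apply: incl_trans Xg _; exact: gY.
  split; [by have [] := phi_bt _ DpX pXY|exact/phiP|exact/phiP].
have [DpX1 _ X1g] := psi_bt X1 DX1 X1Z; have [DpX2 _ X2g] := psi_bt X2 DX2 X2Z.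
have iff1 := phiP _ _ DpX1 DpX2 (incl_trans X1g gY) (incl_trans X2g gY).
exact: iff_trans iff1 (psiP _ _ DX1 DX2 X1Z X2Z).
Qed.

End Maximal.

(** The hypothesis ranges over all families of right ideals because the family used depends on P,
    which is chosen in the proof. The identity embedding of [P, Y] then contradicts
    [no_embedding]. *)
Lemma deviation_proj_eq0 :
  (forall D (lo hi : A -> Prop), (forall I, D I -> right_ideal I) -> D lo -> D hi ->
     has_deviation D (@incl A) lo hi) ->
  exists n, forall x, proj n x = 0.
Proof.
move=> dev; apply: contrapT => ninf.
have Ainf n : exists x, proj n x <> 0.
  apply: contrapT => nx; apply: ninf; exists n => x.
  by apply: contrapT => ?; apply: nx; exists x.
have [P [Pideal Psmall Pmax]] := exists_maximal_graded_ideal Ainf.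
pose D (X : A -> Prop) :=
  [/\ right_ideal X, homogeneous_sub X, incl P X & forall x, X x -> proj 0 x = 0].
pose Y (x : A) := proj 0 x = 0.
have DY : D Y.
  split; last by [].
  - split; rewrite /Y ?proj_zero //.
      by move=> x y x0 y0; rewrite projD x0 y0 addr0.
    move=> x a x0; have [m ->] := proj_sum x; rewrite mulr_suml proj_big big1 // => -[[|i] ?] _ /=.
      by rewrite x0 mul0r proj_zero.
    exact: projMl_lt.
  - by move=> i x; rewrite /Y proj_proj => x0; case: eqP => // ->.
  - by move=> x; exact: maximal_proj0.
apply: (@no_embedding P Pideal Psmall Pmax P Y _ Y DY).
- apply: (dev D); [by move=> I []|exact: D_P|exact: DY].
- move=> YP; apply: Psmall; exists 1%N => x; apply: YP; rewrite /Y proj_proj //.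
exists id; split=> [X DX XY|//]; split=> //; by case: DX.
Qed.

End Graded.

(** * Words *)

Section WordValue.
Variable r : nat.
Implicit Types u v w : seq 'I_r.
Local Open Scope nat_scope.

(* The value in base r; on words of equal length its order is lexicographic. *)
Definition word_value w := foldl (fun n (a : 'I_r) => n * r + a) 0 w.

Lemma word_value_cat u v :
  word_value (u ++ v) = word_value u * r ^ size v + word_value v.
Proof.
rewrite /word_value foldl_cat; move: (foldl _ 0 u) => n.
elim/last_ind: v => [|v a IHv]; first by rewrite expn0 muln1 addn0.
by rewrite -!cats1 !foldl_cat /= IHv size_cat addn1 expnS mulnDl addnA; congr (_ + _ + _); lia.
Qed.

Lemma word_value_lt w : word_value w < r ^ size w.
Proof.
elim/last_ind: w => [|w a IHw]; first by rewrite expn0.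
rewrite -cats1 word_value_cat size_cat /= expn1 addn1 expnS /word_value /= mul0n add0n.
by have := ltn_ord a; move: IHw; rewrite /word_value; nia.
Qed.

Lemma word_value_inj u v : size u = size v -> word_value u = word_value v -> u = v.
Proof.
elim/last_ind: u v => [|u a IHu] v; first by case: v.
case/lastP: v => [|v b]; first by rewrite size_rcons.
rewrite !size_rcons -!cats1 !word_value_cat /= expn1 /word_value /= !mul0n !add0n => -[uv] e.
have ra := ltn_ord a; have rb := ltn_ord b; have r0 : 0 < r by exact: leq_ltn_trans ra.
have ab : a = b.
  by apply: ord_inj; move/(congr1 (modn^~ r)): e; rewrite !modnMDl !modn_small.
rewrite ab in e *; move/addIn: e => /eqP; rewrite eqn_pmul2r // => /eqP e.
by rewrite (IHu _ uv e).
Qed.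

(** The tails contribute less than one unit of the last place of [u] and [v]. *)
Lemma word_value_ltl x u v y z : size u = size v -> size y = size z ->
  word_value u < word_value v ->
  word_value (x ++ u ++ y) < word_value (x ++ v ++ z).
Proof.
move=> uv yz lt; rewrite !word_value_cat !size_cat uv yz ltn_add2l.
have := word_value_lt y; rewrite yz; move: (word_value u) (word_value v) lt => a b ab.
move: (word_value y) (r ^ size z) => c q cq.
by apply: leq_trans (leq_addr _ _); apply: leq_trans (_ : a.+1 * q <= _);
  rewrite ?leq_mul2r ?ab ?orbT // mulSn addnC ltn_add2r.
Qed.

End WordValue.

Section InfiniteWord.
Variables (r : nat) (s : nat -> 'I_r).
Local Open Scope nat_scope.

Definition factor_at i n := mkseq (fun j => s (i + j)) n.

Lemma factor_at_cat i m n :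
  factor_at i m ++ factor_at (i + m) n = factor_at i (m + n).
Proof.
rewrite /factor_at /mkseq iotaD [0 + m]addnC iotaDl map_cat -map_comp.
by congr (_ ++ _); apply: eq_map => j /=; rewrite addnA.
Qed.

Let window i n : n.-tuple 'I_r := [tuple s (i + j) | j < n].

Let windowE i n : window i n = factor_at i n :> seq _.
Proof. by rewrite /= /factor_at /mkseq -val_enum_ord -map_comp. Qed.

Let restrict n (u : n.+1.-tuple 'I_r) : n.-tuple 'I_r :=
  [tuple tnth u (widen_ord (leqnSn n) j) | j < n].

Let restrict_window i n : restrict (window i n.+1) = window i n.
Proof. by apply: eq_from_tnth => j; rewrite !tnth_mktuple. Qed.

Let recurrent n : {set n.-tuple 'I_r} :=
  [set u | `[< forall m, exists2 i, m <= i & window i n = u >]].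

Let recurrentP n (u : n.-tuple 'I_r) :
  reflect (forall m, exists2 i, m <= i & window i n = u) (u \in recurrent n).
Proof. by rewrite inE; exact: asboolP. Qed.

Let eventually_recurrent n : exists m, forall i, m <= i -> window i n \in recurrent n.
Proof.
have bound (u : n.-tuple 'I_r) :
    {m | u \notin recurrent n -> forall i, m <= i -> window i n <> u}.
  apply/cid; have [|/recurrentP/existsNP[m mP]] := boolP (u \in recurrent n).
    by exists 0.
  by exists m => _ i mi iu; apply: mP; exists i.
exists (\max_u sval (bound u)) => i mi; apply: contrapT => /negP nrec.
have [] := svalP (bound (window i n)) nrec i => //.
by apply: leq_trans mi; exact: (@leq_bigmax _ (fun u => sval (bound u))).
Qed.

Let restrict_recurrent n : @restrict n @: recurrent n.+1 = recurrent n.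
Proof.
apply/setP => u; apply/imsetP/recurrentP => [[v /recurrentP vP ->] m|uP].
  by have [i mi <-] := vP m; exists i => //; rewrite restrict_window.
have [M MP] := eventually_recurrent n.+1; have [i Mi <-] := uP M.
by exists (window i n.+1); [exact: MP|rewrite restrict_window].
Qed.

(** At a length where the number of recurrent windows does not grow, restriction is injective on
    them and a recurrent window determines the next letter. The window at [m] returns at some
    [j > m], and both continuations agree for ever. *)
Let few_recurrent_periodic d : (forall n, #|recurrent n| < d) ->
  exists m p, 0 < p /\ forall t, m <= t -> s t = s (t + p).
Proof.
move=> few; have [n nP] : exists n, #|recurrent n.+1| <= #|recurrent n|.
  apply: contrapT => nn; suff le : d <= #|recurrent d| by have := few d; rewrite ltnNge le.
  elim: (d) => // n IHn; apply: leq_ltn_trans IHn _.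
  by rewrite ltnNge; apply/negP => le; apply: nn; exists n.
have /imset_injP inj : #|@restrict n @: recurrent n.+1| == #|recurrent n.+1|.
  by rewrite eqn_leq leq_imset_card restrict_recurrent nP.
have [m mP] := eventually_recurrent n.+1.
have : window m n \in recurrent n by rewrite -restrict_recurrent -restrict_window imset_f ?mP.
move=> /recurrentP/(_ m.+1)[j mj jm]; exists m, (j - m); split; first by rewrite subn_gt0.
have shift t : window (m + t) n.+1 = window (j + t) n.+1.
  elim: t => [|t IHt].
    by apply: inj; rewrite ?mP ?restrict_window ?addn0 // ltnW.
  apply: inj; rewrite ?mP ?leq_addr //; first by rewrite (leq_trans (ltnW mj)) ?leq_addr.
  rewrite !restrict_window; apply: eq_from_tnth => i; rewrite !tnth_mktuple.
  have := congr1 (fun w => tnth w (lift ord0 i)) IHt; rewrite !tnth_mktuple /=.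
  by rewrite /bump /= add1n !addnS !addSn.
move=> t mt; have := congr1 (fun w => tnth w ord0) (shift (t - m)).
rewrite !tnth_mktuple /= !addn0 subnKC // => ->; congr s.
by rewrite addnC addnBAC // addnBA // ltnW.
Qed.

(* Either every window length has fewer than d recurrent windows, and then    *)
(* two consecutive lengths have equally many, so that each recurrent window   *)
(* has a unique continuation; or d recurrent windows of one length can be     *)
(* found one after the other in decreasing order.                             *)
Lemma decreasing_windows_or_periodic d :
  (exists n p, (forall i, p i + n <= p i.+1) /\
     forall i j, i < j < d ->
       word_value (factor_at (p j) n) < word_value (factor_at (p i) n)) \/
  exists m p, 0 < p /\ forall t, m <= t -> s t = s (t + p).
Proof.
have [/few_recurrent_periodic|] := pselect (forall n, #|recurrent n| < d); first by right.
move=> /existsNP[n /negP]; rewrite -leqNgt => many; left.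
pose vals := sort geq [seq word_value u | u : n.-tuple 'I_r <- enum (recurrent n)].
have vals_size : d <= size vals by rewrite size_sort size_map -cardE.
have vals_sorted : sorted gtn vals.
  rewrite gtn_sorted_uniq_geq sort_uniq map_inj_uniq ?enum_uniq ?sort_sorted //.
  by move=> u v /word_value_inj uv; apply: val_inj; apply: uv; rewrite !size_tuple.
(* Each value recurs beyond any [m], so the windows can be placed from left to right without
   overlap. For [i >= d] the position is a dummy. *)
have next i m : {j | m <= j & i < d -> word_value (factor_at j n) = nth 0 vals i}.
  apply/cid2; case: (ltnP i d) => [id|]; last by exists m.
  have : nth 0 vals i \in vals by rewrite mem_nth // (leq_trans id).
  rewrite mem_sort => /mapP[u]; rewrite mem_enum => /recurrentP/(_ m)[j mj <-] ->.
  by exists j => // _; rewrite windowE.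
pose p := fix p i := if i is j.+1 then s2val (next j.+1 (p j + n)) else s2val (next 0 0).
have pP i : i < d -> word_value (factor_at (p i) n) = nth 0 vals i.
  by case: i => [|i] id; [exact: (s2valP' (next 0 0))|exact: (s2valP' (next i.+1 _))].
exists n, p; split=> [i|i j /andP[ij jd]]; first exact: (s2valP (next i.+1 _)).
rewrite !pP ?(ltn_trans ij) //.
apply: (@sorted_ltn_nth _ gtn) => //; rewrite ?inE ?(leq_trans _ vals_size) ?(ltn_trans ij) //.
by move=> x y z; rewrite /gtn /= => yx zy; exact: ltn_trans zy yx.
Qed.

End InfiniteWord.

(** * Words modulo smaller words *)

Section Shirshov.
Variables (k : fieldType) (A : algType k) (r : nat) (g : 'I_r -> A).
Implicit Types u v w : seq 'I_r.

Definition eval_word w := \prod_(a <- w) g a.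

Lemma eval_word_cat u v : eval_word (u ++ v) = eval_word u * eval_word v.
Proof. exact: big_cat. Qed.

Definition subspace (S : A -> Prop) :=
  [/\ S 0, forall x y, S x -> S y -> S (x + y) & forall c x, S x -> S (c *: x)].

(* Quantifying over all subspaces S says that the value of w is a linear       *)
(* combination of the values of smaller words of the same length.             *)
Definition reducible w := forall S, subspace S ->
  (forall v, size v = size w -> (word_value v < word_value w)%N -> S (eval_word v)) ->
  S (eval_word w).

Lemma reducible_factor u x y : reducible u -> reducible (x ++ u ++ y).
Proof.
move=> red S [S0 SD SZ] Sv; rewrite !eval_word_cat mulrA.
apply: (red (fun z => S (eval_word x * z * eval_word y))).
  split=> [|a b Sa Sb|c a Sa]; first by rewrite mulr0 mul0r.
    by rewrite mulrDr mulrDl; exact: SD.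
  by rewrite -scalerAr -scalerAl; exact: SZ.
move=> v vu lt; rewrite -!mulrA -!eval_word_cat; apply: Sv.
  by rewrite !size_cat vu.
exact: word_value_ltl.
Qed.

(** Reducibility applied to the zero subspace: a word vanishes once all smaller words of its length
    do. *)
Lemma reducible_eval0 n : (forall w, size w = n -> reducible w) ->
  forall w, size w = n -> eval_word w = 0.
Proof.
move=> red w; have [m] := ubnP (word_value w); elim: m w => // m IHm w ltm wn.
apply: (red w wn (fun x => x = 0)).
  by split=> [//|x y -> ->|c x ->]; rewrite ?addr0 ?scaler0.
move=> v vw lt; apply: IHm; last by rewrite vw.
exact: leq_trans lt _.
Qed.

(** König's lemma on the tree of irreducible words, which is closed under factors by
    [reducible_factor]. *)
Lemma irreducible_infinite_word :
  (forall n, exists2 w, size w = n & ~ reducible w) ->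
  exists s : nat -> 'I_r, forall i n, ~ reducible (mkseq (fun j => s (i + j)%N) n).
Proof.
move=> irr; pose ext w := forall n, exists2 v, size v = n & ~ reducible (w ++ v).
have step (w : {w | ext w}) : {a : 'I_r | ext (rcons (sval w) a)}.
  apply/cid; case: w => w extw /=; apply: contrapT => nstep.
  have bound a : {n | forall v, size v = n -> reducible (rcons w a ++ v)}.
    apply/cid; apply: contrapT => nb; apply: nstep; exists a => n.
    apply: contrapT => nv; apply: nb; exists n => v vn.
    by apply: contrapT => ?; apply: nv; exists v.
  (* An irreducible extension longer than all bounds begins with some [a], but its prefix cut at the
     bound for [a] is reducible. *)
  have [[//|a v] [vN]] := extw (\max_a sval (bound a)).+1; apply.
  have an : (sval (bound a) <= size v)%N.
    by rewrite vN (@leq_bigmax 'I_r (fun a => sval (bound a))).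
  rewrite -cat_rcons -(cat_take_drop (sval (bound a)) v) catA.
  apply: (@reducible_factor _ [::]); apply: (svalP (bound a)).
  exact: size_takel.
have ext0 : ext [::] by move=> n; have [w wn ?] := irr n; exists w.
pose W := fix W n : {w | ext w} :=
  if n is m.+1 then exist ext (rcons (sval (W m)) (sval (step (W m)))) (svalP (step (W m)))
  else exist ext [::] ext0.
pose s n := sval (step (W n)).
have sW n : mkseq s n = sval (W n).
  by elim: n => // n IHn; rewrite mkseqS IHn.
exists s => i n red; have [v /size0nil-> /=] := svalP (W (i + n)%N) 0%N.
rewrite cats0 -sW; apply.
have -> : mkseq s (i + n) = mkseq s i ++ mkseq (fun j => s (i + j)%N) n ++ [::].
  by rewrite cats0 /mkseq iotaD map_cat add0n -{2}[i]addn0 iotaDl -map_comp.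
exact: reducible_factor.
Qed.

Section Divisible.
Variables (d : nat) (c : 'S_d -> k).
Hypotheses (c1 : c 1%g != 0)
  (c_id : forall y : 'I_d -> A, \sum_(s : 'S_d) c s *: \prod_i y (s i) = 0).

(** The least moved point cannot go down, since all smaller points are their own images. *)
Lemma perm_first_moved (s : 'S_d) : s != 1%g ->
  exists2 t : 'I_d, (forall i : 'I_d, (i < t)%N -> s i = i) & (t < s t)%N.
Proof.
move=> s1; have [i0 i0P] : exists i, s i != i.
  apply: contrapT => ni; move/eqP: s1; apply; apply/permP => i; rewrite perm1.
  by apply: contrapT => /eqP ?; apply: ni; exists i.
have [t tP tmin] := @arg_minnP _ i0 (fun i => s i != i) (fun i : 'I_d => i : nat) i0P.
have fix_lt (i : 'I_d) : (i < t)%N -> s i = i.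
  by move=> it; apply/eqP; apply: contraLR it => /tmin; rewrite -leqNgt.
exists t => //; rewrite ltnNge leq_eqVlt; apply/negP => /orP[/eqP/ord_inj e|/fix_lt].
  by rewrite e eqxx in tP.
by move/perm_inj => e; rewrite e eqxx in tP.
Qed.

Lemma flatten_split (F : 'I_d -> seq 'I_r) (t : 'I_d) :
  flatten [seq F i | i <- enum 'I_d] =
  flatten [seq F i | i <- take t (enum 'I_d)] ++ F t ++
  flatten [seq F i | i <- drop t.+1 (enum 'I_d)].
Proof.
rewrite -[X in flatten (map F X) = _](cat_take_drop t) map_cat flatten_cat.
by rewrite (drop_nth t) ?size_enum_ord //= nth_ord_enum.
Qed.

(** The identity, solved for its term at the trivial permutation, expresses the word through
    permuted blocks. At the first moved position [t] stands a block of larger index, whose prefix of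
    length [n] is smaller. *)
Lemma divisible_reducible (n : nat) (b : 'I_d -> seq 'I_r) :
  (forall i, (n <= size (b i))%N) ->
  (forall i j : 'I_d, (i < j)%N ->
     (word_value (take n (b j)) < word_value (take n (b i)))%N) ->
  reducible (flatten [seq b i | i <- enum 'I_d]).
Proof.
move=> bn dec S [S0 SD SZ] Sv.
have evE (s : 'S_d) : eval_word (flatten [seq b (s i) | i <- enum 'I_d]) =
    \prod_i eval_word (b (s i)).
  by rewrite /eval_word big_flatten big_map enumT [index_enum _]unlock.
have sizeE (s : 'S_d) : size (flatten [seq b (s i) | i <- enum 'I_d]) =
    size (flatten [seq b i | i <- enum 'I_d]).
  rewrite !size_flatten /shape -2!(map_comp size) !sumnE 2!big_map !big_enum /=.
  by rewrite [RHS](reindex_inj (@perm_inj _ s)).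
have id_b : flatten [seq b i | i <- enum 'I_d] =
    flatten [seq b ((1%g : 'S_d) i) | i <- enum 'I_d].
  by congr flatten; apply: eq_map => i; rewrite perm1.
rewrite id_b evE -[X in S X](scalerK c1).
have := c_id (fun i => eval_word (b i)); rewrite (bigD1 1%g) //= => /eqP.
rewrite addr_eq0 => /eqP ->; apply: (SZ); rewrite -scaleN1r; apply: (SZ).
apply: big_ind => // s s1; apply: SZ; rewrite -evE; apply: Sv => //.
have [t fixed lt] := perm_first_moved s1.
have e : [seq b (s i) | i <- take t (enum 'I_d)] = [seq b i | i <- take t (enum 'I_d)].
  apply/eq_in_map => i; rewrite in_take ?mem_enum // index_enum_ord.
  by move=> it; rewrite fixed.
have := sizeE s; rewrite !(flatten_split _ t) e.
rewrite -[b (s t)](cat_take_drop n) -[b t](cat_take_drop n) -!(catA (take _ _)).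
move=> sz; apply: word_value_ltl.
- by rewrite !size_takel.
- move: sz; rewrite !size_cat !(size_takel (bn _)) => /eqP.
  by rewrite !eqn_add2l => /eqP.
- exact: dec.
Qed.

End Divisible.

Theorem nil_words_nilpotent (d : nat) (c : 'S_d -> k) : c 1%g != 0 ->
  (forall y : 'I_d -> A, \sum_(s : 'S_d) c s *: \prod_i y (s i) = 0) ->
  (forall w, w <> [::] -> exists n, eval_word w ^+ n = 0) ->
  exists n, forall w, size w = n -> eval_word w = 0.
Proof.
move=> c1 c_id nil; apply: contrapT => ninf.
have [n|s sP] := irreducible_infinite_word.
  apply: contrapT => nw; apply: ninf; exists n; apply: reducible_eval0 => w wn.
  by apply: contrapT => nred; apply: nw; exists w.
have [[n [p [p_step p_decr]]]|[m [p [p0 per]]]] := decreasing_windows_or_periodic s d.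
  have p_size i : (n <= p i.+1 - p i)%N by rewrite leq_subRL ?p_step // (leq_trans (leq_addr n _)).
  have p_mono i : (p 0 <= p i)%N.
    by elim: i => // i /leq_trans; apply; apply: leq_trans (p_step i); exact: leq_addr.
  (* Each block runs up to the next window, so the blocks are adjacent and begin with the
     windows. *)
  pose b i := factor_at s (p i) (p i.+1 - p i).
  have take_b i : take n (b i) = factor_at s (p i) n.
    by rewrite /b -(subnKC (p_size i)) -factor_at_cat take_size_cat ?size_mkseq.
  have flat : flatten [seq b (val i) | i <- enum 'I_d] = factor_at s (p 0) (p d - p 0).
    rewrite (map_comp b) val_enum_ord -/(mkseq b d).
    elim: (d) => [|e IHe]; first by rewrite subnn.
    rewrite mkseqS flatten_rcons IHe /b -[X in factor_at s X (p e.+1 - _)](subnKC (p_mono e)).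
    rewrite factor_at_cat; congr factor_at; rewrite addnC addnBA // subnK //.
    by apply: leq_trans (p_step e); exact: leq_addr.
  apply: (sP (p 0) (p d - p 0)%N); rewrite -/(factor_at s _ _) -flat.
  apply: (divisible_reducible c1 c_id (n := n)) => [i|i j ij].
    by rewrite size_mkseq.
  by rewrite !take_b; apply: p_decr; rewrite ij ltn_ord.
(* In the periodic case the factors of length [n * p] at [m] are powers of one word. A vanishing
   power is reducible, as 0 lies in every subspace. *)
have shift n : factor_at s (m + p) n = factor_at s m n.
  by apply: eq_map => j; rewrite addnAC -per // leq_addr.
have pow n : eval_word (factor_at s m (n * p)) = eval_word (factor_at s m p) ^+ n.
  elim: n => [|n IHn]; first by rewrite mul0n /eval_word big_nil.
  by rewrite mulSn -factor_at_cat eval_word_cat shift IHn exprS.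
have [|n un] := nil (factor_at s m p).
  by move/(congr1 size); rewrite size_mkseq => p_eq0; rewrite p_eq0 in p0.
by apply: (sP m (n * p)%N) => S [S0 _ _] _; rewrite -/(factor_at s _ _) pow un.
Qed.

End Shirshov.

(** * Multilinear identities *)

Section Polarization.
Variables (k : fieldType) (A : algType k) (I : eqType) (n : nat) (w : 'I_n -> I).
Implicit Types (v : seq I) (u : seq 'I_n) (y : 'I_n -> A).

(** These words index the monomials that arise from [v] when the sum of the [y j] with [w j = i] is
    substituted for each letter [i]. *)
Fixpoint word_lifts v : seq (seq 'I_n) :=
  if v is i :: v' then [seq j :: u | j <- enum [pred j | w j == i], u <- word_lifts v']
  else [:: [::]].

Lemma mem_word_lifts u v : (u \in word_lifts v) = (map w u == v).
Proof.
elim: v u => [|i v IHv] u; first by rewrite inE; case: u.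
apply/allpairsP/eqP => [[[j u'] [/=]]|].
  by rewrite mem_enum inE IHv => /eqP <- /eqP <- ->.
case: u => // j u /= [ji uv]; exists (j, u).
by rewrite mem_enum inE ji eqxx IHv uv eqxx.
Qed.

Lemma word_lifts_uniq v : uniq (word_lifts v).
Proof.
elim: v => // i v IHv; apply: allpairs_uniq; rewrite ?enum_uniq //.
by move=> [j u] [j' u'] _ _ /= [-> ->].
Qed.

Lemma prod_sum_word_lifts y v :
  \prod_(i <- v) \sum_(j | w j == i) y j = \sum_(u <- word_lifts v) \prod_(j <- u) y j.
Proof.
elim: v => [|i v IHv]; first by rewrite big_nil big_seq1 big_nil.
rewrite big_cons IHv big_allpairs_dep big_enum /= mulr_suml.
by apply: eq_bigr => j _; rewrite mulr_sumr; apply: eq_bigr => u _; rewrite big_cons.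
Qed.

Variables (T : eqType) (ms : seq T) (word : T -> seq I) (c : T -> k).
Hypothesis c_id : forall a : I -> A, \sum_(m <- ms) c m *: \prod_(i <- word m) a i = 0.

(* Setting y_j = 0 kills exactly the words that contain j.                    *)
Lemma polarize_hitting (U : seq 'I_n) y :
  \sum_(m <- ms) c m *:
    \sum_(u <- word_lifts (word m) | all [in u] U) \prod_(j <- u) y j = 0.
Proof.
elim: U y => [|j U IHU] y /=.
  rewrite -[RHS](c_id (fun i => \sum_(j | w j == i) y j)).
  by apply: eq_bigr => m _; rewrite prod_sum_word_lifts.
rewrite -[RHS](subrr 0) -[X in _ = X - _](IHU y).
rewrite -[X in _ = _ - X](IHU (fun i => if i == j then 0 else y i)) -sumrB.
apply: eq_bigr => m _; rewrite -scalerBr; congr (_ *: _).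
rewrite [X in _ = X - _](bigID [pred u | j \in u]) [X in _ = _ - X](bigID [pred u | j \in u]) /=.
rewrite [X in _ = _ - (X + _)]big1 ?add0r => [|u /andP[_ ju]].
  rewrite [X in _ = _ - X](_ : _ = \sum_(u <- word_lifts (word m) |
    all [in u] U && (j \notin u)) \prod_(i <- u) y i).
    by rewrite addrK; apply: eq_bigl => u; rewrite andbC.
  apply: eq_bigr => u /andP[_ ju]; apply: eq_big_seq => i iu.
  by case: eqP => // ij; rewrite -ij iu in ju.
by case/splitPr: ju => u1 u2; rewrite big_cat big_cons /= eqxx mul0r mulr0.
Qed.

Let perm_word (s : 'S_n) := [seq s t | t <- enum 'I_n].

Let perm_word_inj : injective perm_word.
Proof. by move=> s t /eq_in_map st; apply/permP => i; apply: st; rewrite mem_enum. Qed.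

Hypothesis size_word : forall m, m \in ms -> (size (word m) <= n)%N.

(** A word of length at most n that contains all n letters is a permutation of them, so the identity
    for [U = enum 'I_n] is multilinear. *)
Lemma polarize_perm y :
  \sum_(s : 'S_n) (\sum_(m <- ms | word m == map w (perm_word s)) c m) *:
    \prod_i y (s i) = 0.
Proof.
rewrite -[RHS](polarize_hitting (enum 'I_n) y).
under eq_bigr => s _ do rewrite scaler_suml.
rewrite (exchange_big_dep xpredT) //=; apply: eq_big_seq => m /size_word m_n.
rewrite -scaler_sumr; congr (_ *: _).
have prodE (s : 'S_n) : \prod_i y (s i) = \prod_(j <- perm_word s) y j.
  by rewrite big_map enumT [index_enum _]unlock.
rewrite (eq_bigr _ (fun s _ => prodE s)).
rewrite -big_filter -(big_map perm_word xpredT (fun u => \prod_(j <- u) y j)).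
rewrite -[RHS]big_filter; apply: perm_big; apply: uniq_perm.
- by rewrite map_inj_uniq ?filter_uniq ?index_enum_uniq.
- by rewrite filter_uniq ?word_lifts_uniq.
move=> u; rewrite mem_filter mem_word_lifts; apply/mapP/andP => [[s]|[/allP full /eqP um]].
  rewrite mem_filter => /andP[/eqP -> _] ->; split=> //; apply/allP => j _.
  by rewrite -[j](permKV s) /=; apply: map_f; rewrite mem_enum.
have u_size : (size u <= size (enum 'I_n))%N.
  by rewrite size_enum_ord -(size_map w) um.
have full' : {subset enum 'I_n <= u} by move=> j /full.
have u_uniq := leq_size_uniq (enum_uniq _) full' u_size.
have size_u : size u = n.
  by have [<- _] := uniq_min_size (enum_uniq _) full' u_size; rewrite size_enum_ord.
pose f (t : 'I_n) := tnth (tcast size_u (in_tuple u)) t.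
have f_inj : injective f.
  by apply/tuple_uniqP; rewrite val_tcast.
exists (perm f_inj); last first.
  rewrite /perm_word (eq_map (permE f_inj)) map_tnth_enum val_tcast //.
rewrite mem_filter mem_index_enum andbT -um; apply/eqP; congr map.
by rewrite /perm_word (eq_map (permE f_inj)) map_tnth_enum val_tcast.
Qed.

End Polarization.

Lemma satisfies_pi_multilinear (k : fieldType) (A : algType k) : satisfies_pi A ->
  exists n (c : 'S_n -> k), c 1%g != 0 /\
    forall y : 'I_n -> A, \sum_(s : 'S_n) c s *: \prod_i y (s i) = 0.
Proof.
move=> [d [f [f0 fP]]]; pose ms := enum_fset (msupp f).
have c_id (a : 'I_d -> A) : \sum_(m <- ms) f@_m *: \prod_(i <- (m : {fmonom 'I_d})) a i = 0.
  rewrite -[RHS](fP a) mmapE; apply: eq_bigr => m _.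
  by rewrite /= mulr_algl.
have ms_supp m : (m \in ms) = (f@_m != 0) by rewrite mcoeff_neq0.
have [m0 m0s] : exists m, m \in ms.
  apply: contrapT => nm; move/eqP: f0; apply; apply/malgP => m; rewrite mcoeff0.
  by apply/eqP; apply: contrapT => /negP; rewrite -ms_supp => ms_m; apply: nm; exists m.
(* [m] is a longest monomial of the support; the new variables are its positions. *)
have [j0 /hasP[m ms_m /eqP m_j0] maxj] : {j | has (fun m : {fmonom 'I_d} => size m == j) ms &
    forall i, has (fun m : {fmonom 'I_d} => size m == i) ms -> (i <= j)%N}.
  have ex : exists j, has (fun m : {fmonom 'I_d} => size m == j) ms.
    by exists (size m0); apply/hasP; exists m0.
  have bnd j : has (fun m : {fmonom 'I_d} => size m == j) ms ->
      (j <= \max_(m <- ms) size (m : {fmonom 'I_d}))%N.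
    by case/hasP => m ms_m /eqP <-; exact: leq_bigmax_seq.
  by exists (ex_maxn ex bnd); case: ex_maxnP.
have size_ms (m' : {fmonom 'I_d}) : m' \in ms -> (size m' <= size m)%N.
  by move=> ms_m'; rewrite m_j0; apply: maxj; apply/hasP; exists m'.
pose w := tnth (in_tuple m).
exists (size m), (fun s => \sum_(m' <- ms | m' == map w [seq s t | t <- enum 'I_(size m)] :> seq _)
  f@_m').
split; last by move=> y; exact: (polarize_perm _ c_id size_ms).
(* The trivial permutation spells [m], so its coefficient is the nonzero one of [m] in [f]. *)
rewrite (eq_map (@perm1 _)) map_id map_tnth_enum /=.
rewrite big_mkcond (bigD1_seq m) ?fset_uniq //= eqxx big1 ?addr0 -?ms_supp // => m' m'm.
by case: eqP => // /val_inj e; rewrite e eqxx in m'm.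
Qed.

Lemma commutator_power_satisfies_pi (k : fieldType) (A : algType k) n :
  (forall x y : A, (x * y - y * x) ^+ n = 0) -> satisfies_pi A.
Proof.
move=> nil; pose h (B : algType k) (a : 'I_2 -> B) (m : {fmonom 'I_2}) := \prod_(i <- m) a i.
have hM (B : algType k) (a : 'I_2 -> B) : mmorphism (h B a).
  split=> [m1 m2|]; first by rewrite /h fmM big_cat.
  by rewrite /h fm1 big_nil.
pose U i : {malg k[{fmonom 'I_2}]} := << fmu i >>.
pose f := (U 0 * U 1 - U 1 * U 0) ^+ n.
have fE (B : algType k) (a : 'I_2 -> B) :
    mmap (in_alg B) (h B a) f = (a 0 * a 1 - a 1 * a 0) ^+ n.
  pose hB : {mmorphism {fmonom 'I_2} -> B} :=
    HB.pack (h B a) (monalg.isMultiplicative.Build _ _ _ (hM B a)).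
  have [MM M1] : multiplicative (mmap (in_alg B) hB).
    apply: commr_mmap_is_multiplicative => g m m'; rewrite /GRing.comm.
    by rewrite /= mulr_algl mulr_algr.
  have UE i : mmap (in_alg B) hB (U i) = a i.
    by rewrite /U mmapU /= scale1r mul1r /h fmU big_seq1.
  rewrite -[h B a]/(hB : _ -> _) /f.
  elim: n {nil f} => [|n IHn]; first by rewrite !expr0.
  by rewrite !exprS MM IHn raddfB /= !MM !UE.
exists 2%N, f; split; last by move=> a; rewrite fE nil.
(* The polynomial is nonzero as it does not vanish on 2 x 2 matrices: the commutator of these matrix
   units is diag(1, -1), whose powers have entry 1 at (0, 0). *)
apply/eqP => f0; pose a (i : 'I_2) : 'M[k]_2 := if i == 0 then delta_mx 0 1 else delta_mx 1 0.
have := fE _ a; rewrite f0 raddf0 => /esym /matrixP /(_ 0 0) /eqP; rewrite mxE.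
suff -> : ((a 0 * a 1 - a 1 * a 0) ^+ n) 0 0 = 1 by rewrite oner_eq0.
set e := _ - _; have e0 j : e 0 j = (j == 0)%:R.
  have -> : e = (delta_mx 0 1 : 'M_2) *m (delta_mx 1 0 : 'M_2) -
                (delta_mx 1 0 : 'M_2) *m (delta_mx 0 1 : 'M_2) by [].
  by rewrite !mul_delta_mx !mxE /= subr0.
elim: n {nil f f0 fE} => [|n IHn]; first by rewrite expr0 mxE.
rewrite exprS -[_ * _]/(e *m e ^+ n) mxE big_ord_recl big_ord1 !e0 /=.
by rewrite IHn mul1r mul0r addr0.
Qed.

(** * Finite dimensional algebras *)

Lemma span_subspace (k : fieldType) (M : algType k) (X : {pred M}) (S : M -> Prop) x :
  subspace S -> (forall y, y \in X -> S y) -> x \in Defs.span X -> S x.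
Proof.
move=> [S0 SD SZ] XS /Defs.spanP[n [c [v [Xv ->]]]].
by apply: big_ind => // i _; apply/SZ/XS.
Qed.

Lemma submod_subspace (k : fieldType) (M : algType k) (N : submodClosed M) :
  subspace (fun x => x \in N).
Proof. by split=> [|x y|c x]; [exact: rpred0|exact: rpredD|exact: rpredZ]. Qed.

Lemma infinitely_often_subsequence (P : nat -> Prop) :
  (forall n, exists2 i, (n <= i)%N & P i) ->
  exists t : nat -> nat, (forall j, (t j < t j.+1)%N) /\ forall j, P (t j).
Proof.
move=> inf; have next n : {i | (n <= i)%N & P i} by apply/cid2/inf.
pose t := fix t j := if j is l.+1 then s2val (next (t l).+1) else s2val (next 0%N).
exists t; split=> [j|[|j]]; first exact: (s2valP (next (t j).+1)).
  exact: (s2valP' (next 0%N)).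
exact: (s2valP' (next (t j).+1)).
Qed.

Section FiniteDimensional.
Variables (k : fieldType) (M : algType k).
Hypothesis M_fin : finite_dimensional M.

(* A strict chain of length m in M yields an m-dimensional space of           *)
(* coordinate vectors.                                                        *)
Lemma strict_chain_bounded : exists n, forall m (f : nat -> M -> Prop),
  (forall i, subspace (f i)) ->
  (forall i, (i < m)%N -> incl (f i) (f i.+1) /\ ~ incl (f i.+1) (f i)) -> (m <= n)%N.
Proof.
have [s sP] := M_fin; pose n := size s; exists n => m f fsub fstrict.
pose phi (v : 'rV[k]_n) := \sum_i v 0 i *: s`_i.
have phiD v w : phi (v + w) = phi v + phi w.
  by rewrite -big_split; apply: eq_bigr => i _; rewrite mxE scalerDl.
have phiZ c v : phi (c *: v) = c *: phi v.
  by rewrite scaler_sumr; apply: eq_bigr => i _; rewrite mxE scalerA.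
have phi_surj x : exists v, x = phi v.
  have : x \in Defs.span [in s] by rewrite -sP.
  apply: (span_subspace (S := fun x => exists v, x = phi v)) => [|y].
    split=> [|_ _ [v ->] [w ->]|c _ [v ->]].
    - by exists 0; rewrite /phi big1 // => i _; rewrite mxE scale0r.
    - by exists (v + w); rewrite phiD.
    - by exists (c *: v); rewrite phiZ.
  move=> /(nthP 0)[i ilt <-]; exists (delta_mx 0 (Ordinal ilt)).
  rewrite /phi (bigD1 (Ordinal ilt)) //= mxE !eqxx scale1r big1 ?addr0 // => j ji.
  by rewrite mxE eqxx (negbTE ji) scale0r.
suff [B [_ Bm]] : exists B : 'M[k]_n, (forall v : 'rV_n, (v <= B)%MS -> f m (phi v)) /\
    (m <= \rank B)%N.
  exact: leq_trans Bm (rank_leq_row _).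
elim: m fstrict => [|m IHm] fstrict.
  exists 0; split=> // v; rewrite submx0 => /eqP ->.
  by rewrite /phi big1 => [|i _]; [have [] := fsub 0%N|rewrite mxE scale0r].
have [i im|B [fB Bm]] := IHm; first by apply: fstrict; exact: ltnW.
(* Coordinates of an element outside [f m] are not in the row space of [B], so adding them raises
   the rank. *)
have [fm /existsNP[x /not_implyP[fx nfx]]] := fstrict m (ltnSn m).
have [v xv] := phi_surj x; have [f0 fD fZ] := fsub m.+1.
exists (B + v)%MS; split=> [u /sub_addsmxP[[u1 u2] /= ->]|].
  rewrite phiD; apply: fD; first by apply/fm/fB/submxMl.
  by rewrite (mx11_scalar u2) mul_scalar_mx phiZ -xv; apply: fZ.
apply: leq_trans (_ : \rank B < _)%N; first by [].
apply: rank_ltmx; rewrite ltmxE addsmxSl /=; apply/negP => le.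
by apply: nfx; rewrite xv; apply: fB; apply: submx_trans le; exact: addsmxSr.
Qed.

Lemma ascending_chain_stable (f : nat -> M -> Prop) :
  (forall i, subspace (f i)) -> (forall i, incl (f i) (f i.+1)) ->
  exists n, forall i, (n <= i)%N -> incl (f i.+1) (f i).
Proof.
move=> fsub fasc; have [b bP] := strict_chain_bounded.
have mono i j : (i <= j)%N -> incl (f i) (f j).
  move/subnKC <-; elim: (j - i)%N => [|d IHd]; first by rewrite addn0.
  by rewrite addnS; exact: incl_trans IHd (fasc _).
apply: contrapT => nstable.
have [n|t [tlt tjump]] := @infinitely_often_subsequence (fun i => ~ incl (f i.+1) (f i)).
  apply: contrapT => nj; apply: nstable; exists n => i ni.
  by apply: contrapT => ?; apply: nj; exists i.
suff : (b.+1 <= b)%N by rewrite ltnn.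
apply: (bP _ (f \o t)) => [j|j _ /=]; first exact: fsub.
split; first exact/mono/ltnW.
by move=> le; apply: (tjump j); apply: incl_trans le; exact: mono.
Qed.

Lemma descending_chain_stable (f : nat -> M -> Prop) :
  (forall i, subspace (f i)) -> (forall i, incl (f i.+1) (f i)) ->
  exists n, forall i, (n <= i)%N -> incl (f i) (f i.+1).
Proof.
move=> fsub fdesc; have [b bP] := strict_chain_bounded.
have mono i j : (i <= j)%N -> incl (f j) (f i).
  move/subnKC <-; elim: (j - i)%N => [|d IHd]; first by rewrite addn0.
  by rewrite addnS; exact: incl_trans (fdesc _) IHd.
apply: contrapT => nstable.
have [n|t [tlt tjump]] := @infinitely_often_subsequence (fun i => ~ incl (f i) (f i.+1)).
  apply: contrapT => nj; apply: nstable; exists n => i ni.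
  by apply: contrapT => ?; apply: nj; exists i.
suff : (b.+1 <= b)%N by rewrite ltnn.
(* The first b + 2 members of the subsequence, reversed, form a strictly ascending chain of length b
   + 1. *)
apply: (bP _ (fun j => f (t (b.+1 - j)%N))) => [j|j jb /=]; first exact: fsub.
rewrite (_ : (b.+1 - j = (b.+1 - j.+1).+1)%N); last by lia.
set i := (_ - _)%N; split; first exact/mono/ltnW.
by move=> le; apply: (tjump i); apply: incl_trans le _; exact: mono.
Qed.

End FiniteDimensional.

Section FiniteDimensionalAlgebra.
Variables (k : fieldType) (A : algType k).
Hypothesis A_fin : finite_dimensional A.

Let right_submod_subspace (N : submodClosed (A^c)^o) : subspace (fun x : A => x \in N).
Proof.
split=> [|x y|c x Nx]; [exact: (rpred0 N)|move=> Nx Ny|].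
  exact: (@rpredD _ N x y Nx Ny).
rewrite -[x]mulr1 scalerAr; exact: (@rpredZ _ _ N (c%:A : A^c) x Nx).
Qed.

Lemma finite_dimensional_right_noetherian : right_noetherian A.
Proof.
move=> N Nasc; have [|i x|n nP] := @ascending_chain_stable _ _ A_fin (fun i x => x \in N i).
- by move=> i; exact: right_submod_subspace.
- exact: Nasc.
exists n => i /subnKC <- x; elim: (i - n)%N => [|d IHd]; first by rewrite addn0.
rewrite -IHd addnS; apply/idP/idP; last exact: Nasc.
by apply: nP; exact: leq_addr.
Qed.

Lemma finite_dimensional_right_krull_dim : has_right_krull_dim A.
Proof.
right; have wf : well_founded (fun b a : nat => (b < a)%O).
  by elim/ltn_ind => n IHn; split=> m; rewrite Order.NatOrder.ltEnat; exact: IHn.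
(* The dimension is 0: no ordinal lies below it, so late factors must vanish. *)
exists _, nat, wf, 0%N; rewrite krull_dimE; split.
  move=> [A0|[b [//]]]; have /eqP := A0 (1 : A); apply/negP; exact: oner_neq0.
move=> N Ndesc; have [|i x|n nP] := @descending_chain_stable _ _ A_fin (fun i x => x \in N i).
- by move=> i; exact: right_submod_subspace.
- exact: Ndesc.
exists n => i /nP sub; left; elim/factorW => x; apply/eqP/factorP.
by rewrite subr0; apply/sub/valP.
Qed.

End FiniteDimensionalAlgebra.

(** * The associated graded ring and stationary filtrations *)

Section AssociatedGraded.
Variables (k : fieldType) (R : algType k) (V : submodClosed R).
Hypothesis V_1 : 1 \in V.
Local Notation A := (gr V).

Lemma homog_subproof i (a : R) :
  exists n, forall j, (n <= j)%N -> (if j == i then cls V j a else 0) = 0.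
Proof. by exists i.+1 => j; case: eqP => // ->; rewrite ltnn. Qed.

(* Junk unless a is in V^i, see cls. *)
Definition homog i a : A := Gr (homog_subproof i a).

Lemma proj_subproof i (x : A) :
  exists n, forall j, (n <= j)%N -> (if j == i then x j else 0) = 0.
Proof. by have [n xn] := gr_finite x; exists n => j /xn ->; case: ifP. Qed.

Definition gr_proj i (x : A) : A := Gr (proj_subproof i x).

Lemma lifts_homog i a : a \in power V i ->
  lifts (fun j => if j == i then a else 0) (homog i a).
Proof.
by move=> Va j; rewrite /homog /=; case: eqP => [->|_]; split=> //; rewrite ?rpred0 ?cls0.
Qed.

Lemma homogM i j a b : a \in power V i -> b \in power V j ->
  homog i a * homog j b = homog (i + j)%N (a * b).
Proof.
move=> Va Vb; apply: grP; have Vab := powerM Va Vb.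
apply: (lifts_inj (lifts_mul (lifts_homog Va) (lifts_homog Vb)) (lifts_homog Vab)) => n.
rewrite /conv; case: eqP => [->|nij].
  have ij : (i < (i + j).+1)%N by rewrite ltnS leq_addr.
  rewrite (bigD1 (Ordinal ij)) //= addKn !eqxx big1 ?addr0 // => l li.
  by rewrite -val_eqE /= in li; rewrite (negbTE li) mul0r.
apply: big1 => l _; case: eqP => [li|]; last by rewrite mul0r.
case: eqP => [nl|]; last by rewrite mulr0.
by case: nij; rewrite -nl -li subnKC // leq_ord.
Qed.

Lemma homogD i a b : a \in power V i -> b \in power V i ->
  homog i (a + b) = homog i a + homog i b.
Proof.
move=> Va Vb; apply: grP => j /=.
by rewrite /gr_add /=; case: eqP => [->|_]; rewrite ?addr0 // clsD.
Qed.

Lemma homogZ i c a : a \in power V i -> homog i (c *: a) = c *: homog i a.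
Proof.
move=> Va; apply: grP => j /=.
by rewrite /gr_scale /=; case: eqP => [->|_]; rewrite ?scaler0 // clsZ.
Qed.

Lemma homog_eq0 i a : a \in power V i -> (homog i a = 0) <-> (a \in prev_power V i).
Proof.
move=> Va; rewrite -cls_eq0 //; split=> [/(congr1 (fun x : A => x i)) /=|/eqP a0].
  by rewrite eqxx => ->; exact: eqxx.
by apply: grP => j /=; case: eqP => // ->.
Qed.

Lemma homog_zero i : homog i 0 = 0.
Proof. by apply/homog_eq0; rewrite rpred0. Qed.

Lemma gr_projP i x : exists2 a, a \in power V i & gr_proj i x = homog i a.
Proof.
have [a ax] := liftsW x; have [Va xi] := ax i; exists (a i) => //.
by apply: grP => j /=; case: eqP => // ->.
Qed.

Lemma gr_proj_homog i j a : gr_proj j (homog i a) = if i == j then homog i a else 0.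
Proof.
apply: grP => l; case: (eqVneq i j) => [->|ij] /=; first by case: (l == j).
by case: eqP => // ->; rewrite eq_sym (negbTE ij).
Qed.

Lemma gr_projD i : {morph gr_proj i : x y / x + y}.
Proof. by move=> x y; apply: grP => j /=; rewrite /gr_add /=; case: eqP; rewrite ?addr0. Qed.

Lemma gr_proj_proj i j x : gr_proj j (gr_proj i x) = if i == j then gr_proj i x else 0.
Proof. by have [a _ ->] := gr_projP i x; exact: gr_proj_homog. Qed.

Lemma gr_sumE n (F : 'I_n -> A) j : (\sum_i F i) j = \sum_i F i j.
Proof. by apply: (big_morph (fun x : A => x j)). Qed.

Lemma gr_proj_sum x : exists n, x = \sum_(i < n) gr_proj i x.
Proof.
have [n xn] := gr_finite x; exists n; apply: grP => j; rewrite gr_sumE.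
have [nj|jn] := leqP n j.
  by rewrite xn // big1 // => i _ /=; rewrite xn ?if_same.
rewrite (bigD1 (Ordinal jn)) //= eqxx big1 ?addr0 // => i ij.
by rewrite -val_eqE eq_sym in ij; rewrite (negbTE ij).
Qed.

Lemma power_subset m n : (m <= n)%N -> {subset power V m <= power V n}.
Proof.
move=> /subnKC <- x Vx; elim: (n - m)%N => [|d IHd]; first by rewrite addn0.
rewrite addnS -[x]mulr1 -addn1; apply: powerM => //.
apply/Defs.sub_span/asboolP; exists (fun=> 1); split=> // .
by rewrite big_ord1.
Qed.

Lemma power_scalar x : x \in power V 0 -> exists c, x = c%:A.
Proof.
apply: (span_subspace (S := fun x => exists c, x = c%:A)).
  split=> [|_ _ [c ->] [d ->]|c _ [d ->]]; first by exists 0; rewrite scale0r.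
    by exists (c + d); rewrite scalerDl.
  by exists (c * d); rewrite scalerA.
by move=> y /asboolP[v [_ ->]]; exists 1; rewrite big_ord0 scale1r.
Qed.

Lemma power_split i j (S : R -> Prop) : subspace S ->
  (forall x y, x \in power V i -> y \in power V j -> S (x * y)) ->
  forall z, z \in power V (i + j)%N -> S z.
Proof.
move=> Ssub Sxy z; apply: span_subspace => // y /asboolP[v [Vv ->]].
rewrite big_split_ord /=; apply: Sxy; apply/Defs.sub_span/asboolP.
  by exists (fun l => v (lshift j l)).
by exists (fun l => v (rshift i l)).
Qed.

Lemma power_expn i a n : a \in power V i -> a ^+ n \in power V (n * i)%N.
Proof.
move=> Va; elim: n => [|n IHn]; first by rewrite expr0; exact: power0_1.
by rewrite exprS mulSn; exact: powerM.
Qed.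

Lemma gr_scalarE c : c%:A = homog 0 c%:A.
Proof.
apply: grP => -[|j] /=; last by rewrite /one_family /= cls0 scaler0.
by rewrite clsZ // power0_1.
Qed.

Lemma homog_expn i a n : a \in power V i -> homog i a ^+ n = homog (n * i)%N (a ^+ n).
Proof.
move=> Va; elim: n => [|n IHn]; last by rewrite exprS IHn homogM ?power_expn // exprS mulSn.
by rewrite !expr0 mul0n; have := gr_scalarE 1; rewrite !scale1r.
Qed.

(** For l < n the power a^l lies in V^(l i), which is inside V^(n i - 1) because i > 0. *)
Lemma homog_nilpotent i a : algebraic R -> (0 < i)%N -> a \in power V i ->
  exists n, homog i a ^+ n = 0.
Proof.
move=> R_alg i_gt0 Va; have [p p0 /rootP pa] := R_alg a.
set n := (size p).-1; exists n; rewrite homog_expn //.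
apply/homog_eq0; first exact: power_expn.
have pn : size p = n.+1 by rewrite prednK // lt0n size_poly_eq0.
have lead : p`_n != 0 by rewrite -[p`_n]/(lead_coef p) lead_coef_eq0.
have coefE l : (map_poly (in_alg R) p)`_l * a ^+ l = p`_l *: a ^+ l.
  by rewrite coef_map /= mulr_algl.
move: pa; rewrite horner_coef size_map_poly pn big_ord_recr /= coefE => /eqP.
rewrite addrC addr_eq0 => /eqP an; rewrite -[a ^+ n](scalerK lead) an scalerN submodN.
apply/rpredZ/rpred_sum => l _; rewrite coefE; apply: rpredZ.
have : (l * i < n * i)%N by rewrite ltn_pmul2r.
case: (n * i)%N => // m; rewrite ltnS => lm.
exact: (power_subset lm (power_expn l Va)).
Qed.

Definition stationary := exists n, {subset power V n <= prev_power V n}.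

(** V^m is spanned by V^n V^(m-n), and V^n lies in V^(n-1). *)
Lemma stationary_after n : {subset power V n <= prev_power V n} ->
  forall m, (n <= m)%N -> {subset power V m <= prev_power V m}.
Proof.
move=> st m /subnKC <- x; apply: (power_split (S := fun z => z \in prev_power V (n + (m - n))%N))
  => [|a b Va Vb].
  exact: submod_subspace.
by apply: prev_powerMl => //; exact: st.
Qed.

Lemma stationary_homog n : {subset power V n <= prev_power V n} ->
  forall i x, (n <= i)%N -> gr_proj i x = 0.
Proof.
move=> st i x ni; have [a Va ->] := gr_projP i x; apply/homog_eq0 => //.
exact: stationary_after st _ ni _ Va.
Qed.

Lemma gr_comp_proj i (x : A) : gr_proj i x = 0 -> x i = 0.
Proof. by move/(congr1 (fun y : A => y i)) => /=; rewrite eqxx. Qed.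

Lemma gr_proj_comp i (x : A) : x i = 0 -> gr_proj i x = 0.
Proof. by move=> xi; apply: grP => j /=; case: eqP => // ->. Qed.

Lemma gr_proj_stationary n : (forall x, gr_proj n x = 0) -> stationary.
Proof.
move=> pn; exists n => a Va; apply/homog_eq0 => //.
by rewrite -[RHS](pn (homog n a)) gr_proj_homog eqxx.
Qed.

Definition low n (x : A) := forall i, (i < n)%N -> x i = 0.

Lemma low_mul n (x y : A) : x 0%N = 0 -> low n y -> low n.+1 (x * y).
Proof.
move=> x0 yn i; rewrite ltnS => i_n; apply: big1 => j _; apply: mul_component0.
case: (posnP j) => [j0|j0]; [left; by case: j j0 => -[|//] ? _|right; apply: yn].
by apply: leq_trans i_n; rewrite ltn_subrL j0 (leq_trans j0) // -ltnS.
Qed.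

Lemma low_stationary_eq0 n x : {subset power V n <= prev_power V n} -> low n x -> x = 0.
Proof.
move=> st xn; apply: grP => i; have [ni|] := leqP n i; last exact: xn.
by apply: gr_comp_proj; exact: stationary_homog st _ _ ni.
Qed.

(** A product of n + 1 elements of [gr_plus] has no part below degree n + 1, and the other
    components vanish. The exponent n + 1 is positive even if n = 0. *)
Lemma stationary_nilpotent : stationary ->
  exists2 n, (0 < n)%N & power (gr_plus (V := V)) n =i pred1 0.
Proof.
move=> [n st]; exists n.+1 => // x; rewrite [RHS]inE; apply/idP/eqP => [|->]; last exact: rpred0.
apply: (span_subspace (S := fun y => y = 0)).
  by split=> [//|y z -> ->|c y ->]; rewrite ?addr0 ?scaler0.
move=> y /asboolP[v [v_plus ->]].
apply: (low_stationary_eq0 (stationary_after st (leqnSn n))).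
elim: n.+1 v v_plus => [|m IHm] v v_plus; first by [].
rewrite big_ord_recl; apply: low_mul; last exact: IHm.
exact/eqP/v_plus.
Qed.

Lemma stationary_satisfies_pi : stationary -> satisfies_pi A.
Proof.
move=> [n st]; apply: (commutator_power_satisfies_pi (n := n)) => x y.
apply: (low_stationary_eq0 st).
(* Degree 0 consists of scalars, so commutators lie in [gr_plus] and their n-th powers in degrees at
   least n. *)
have comm0 : (x * y - y * x : A) 0%N = 0.
  apply/eqP; change ((x * y : A) 0%N - (y * x : A) 0%N == 0).
  rewrite subr_eq0; apply/eqP.
  have [a ax] := liftsW x; have [b by_] := liftsW y.
  rewrite -[LHS]/(mul_family x y 0) -[RHS]/(mul_family y x 0).
  have [_ <-] := lifts_mul ax by_ 0%N; have [_ <-] := lifts_mul by_ ax 0%N.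
  rewrite /conv !big_ord1; have [/power_scalar[c ->] _] := ax 0%N.
  by rewrite mulr_algl mulr_algr.
elim: n {st} => [|n IHn]; first by [].
by rewrite exprS; exact: low_mul.
Qed.

End AssociatedGraded.

(** * Words in the generators and the six conditions *)

Section Generators.
Variables (k : fieldType) (R : algType k) (V : submodClosed R) (s : seq R).
Hypotheses (V_1 : 1 \in V) (V_s : V =i Defs.span [in s]).
Local Notation A := (gr V).

Let g (i : 'I_(size s)) := s`_i.

Let power1 a : a \in V -> a \in power V 1.
Proof.
by move=> Va; apply/Defs.sub_span/asboolP; exists (fun=> a); rewrite big_ord1.
Qed.

Let g_power1 i : g i \in power V 1.
Proof. by apply: power1; rewrite V_s; apply: Defs.sub_span; exact: mem_nth. Qed.

Let word_power w : eval_word g w \in power V (size w).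
Proof.
elim: w => [|i w IHw]; first by rewrite /eval_word big_nil; exact: power0_1.
by rewrite /eval_word big_cons; exact: (powerM (g_power1 i) IHw).
Qed.

Lemma power_words n (S : R -> Prop) : subspace S ->
  (forall w, size w = n -> S (eval_word g w)) -> forall a, a \in power V n -> S a.
Proof.
elim: n S => [|n IHn] S Ssub Sw a; apply: span_subspace => // _ /asboolP[v [Vv ->]].
  by have := Sw [::] erefl; rewrite /eval_word big_nil big_ord0.
rewrite big_ord_recl; have [S0 SD SZ] := Ssub.
apply: (IHn (fun z => S (v ord0 * z))) => [|w wn|].
- split=> [|x y Sx Sy|c x Sx]; first by rewrite mulr0.
    by rewrite mulrDr; exact: SD.
  by rewrite -scalerAr; exact: SZ.
- have : v ord0 \in Defs.span [in s] by rewrite -V_s.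
  apply: (span_subspace (S := fun z => S (z * eval_word g w))) => [|_ /(nthP 0)[i ilt <-]].
    split=> [|x y Sx Sy|c x Sx]; first by rewrite mul0r.
      by rewrite mulrDl; exact: SD.
    by rewrite -scalerAl; exact: SZ.
  have -> : s`_i * eval_word g w = eval_word g (Ordinal ilt :: w).
    by rewrite /eval_word big_cons.
  by apply: Sw; rewrite /= wn.
- by apply/Defs.sub_span/asboolP; exists (fun i => v (lift ord0 i)).
Qed.

Lemma homog_word w :
  homog V (size w) (eval_word g w) = eval_word (fun i => homog V 1 (g i)) w.
Proof.
elim: w => [|i w IHw].
  by rewrite /eval_word !big_nil -[X in homog V _ X]scale1r -gr_scalarE scale1r.
by rewrite {2}/eval_word big_cons -/(eval_word _ _) -IHw homogM // /eval_word big_cons.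
Qed.

Let words n : seq R := [seq eval_word g (val w) | w : n.-tuple 'I_(size s)].

Let mem_words n w : size w = n -> eval_word g w \in words n.
Proof.
by move/eqP => wn; apply/mapP; exists (Tuple wn); rewrite ?mem_enum.
Qed.

Let homog_words_span n (X : {pred A}) :
  (forall w, size w = n -> homog V n (eval_word g w) \in X) ->
  forall x, gr_proj n x \in Defs.span X.
Proof.
move=> Xw x; have [a Va ->] := gr_projP n x; move: (Va).
have [S0 SD SZ] := @submod_subspace _ A (Defs.span X).
suff : a \in power V n /\ homog V n a \in Defs.span X by case.
apply: (@power_words n (fun a => a \in power V n /\ homog V n a \in Defs.span X)) Va.
  split=> [|b c [Vb Xb] [Vc Xc]|c b [Vb Xb]]; first by rewrite rpred0 homog_zero.
    by rewrite rpredD // homogD //; split=> //; exact: SD.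
  by rewrite rpredZ // homogZ //; split=> //; exact: SZ.
move=> w wn; split; first by rewrite -wn.
by apply: Defs.sub_span; exact: Xw.
Qed.

Lemma stationary_gr_finite_dimensional : stationary V -> finite_dimensional A.
Proof.
move=> [n st]; exists (flatten [seq [seq homog V i x | x <- words i] | i <- iota 0 n]) => x.
rewrite [LHS]inE; apply/esym; have [m ->] := gr_proj_sum x; apply: rpred_sum => i _.
have [ni|i_n] := leqP n i; first by rewrite (stationary_homog st) ?rpred0.
apply: homog_words_span => w wn; apply/flattenP.
exists [seq homog V i x | x <- words i]; last by apply: map_f; exact: mem_words.
by apply: map_f; rewrite mem_iota.
Qed.

Lemma stationary_finite_dimensional : generates V -> stationary V -> finite_dimensional R.
Proof.
move=> V_gen [n st].
(* The union of all V^m is a subalgebra containing V, hence all of R. *)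
pose U : {pred R} := fun x => `[< exists m, x \in power V m >].
have Ualg : subalg_closed U.
  split=> [|c x y /asboolP[i Vx] /asboolP[j Vy]|x y /asboolP[i Vx] /asboolP[j Vy]]; apply/asboolP.
  - by exists 0%N; exact: power0_1.
  - exists (maxn i j); apply: rpredD; first apply: rpredZ.
      exact: (power_subset V_1 (leq_maxl i j) Vx).
    exact: (power_subset V_1 (leq_maxr i j) Vy).
  - by exists (i + j)%N; exact: powerM.
pose B : subalgClosed R :=
  HB.pack U (GRing.isSubalgClosed.Build k R U (GRing.subalg_closed_semi Ualg)).
have Vn x : x \in power V n.
  have /asboolP[m] : x \in B.
    by apply: V_gen => y Vy; apply/asboolP; exists 1%N; exact: power1.
  have [mn|nm] := leqP m n; first exact: (power_subset V_1 mn).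
  rewrite -(subnKC (ltnW nm)); elim: (m - n)%N => [|d IHd]; first by rewrite addn0.
  rewrite addnS => Vx; apply: IHd.
  have le : (n <= (n + d).+1)%N by rewrite leqW ?leq_addr.
  exact: (stationary_after st le Vx).
exists (words n) => x; rewrite [LHS]inE; apply/esym.
apply: (@power_words n (fun x => x \in Defs.span [in words n])) (Vn x).
  exact: submod_subspace.
by move=> w wn; apply: Defs.sub_span; exact: mem_words.
Qed.

(** By [homog_word] the class of a word of length n is a product of n elements of [gr_plus]. *)
Lemma nilpotent_stationary n : power (gr_plus (V := V)) n =i pred1 0 -> stationary V.
Proof.
move=> nil; exists n => a Va.
apply: (@power_words n (fun a => a \in prev_power V n)) Va; first exact: submod_subspace.
move=> w wn; apply/homog_eq0; first by rewrite -wn.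
apply/eqP; rewrite -[_ == 0]/(_ \in pred1 0) -nil -wn homog_word.
apply/Defs.sub_span/asboolP; exists (fun i => homog V 1 (g (tnth (in_tuple w) i))).
split=> [i|]; last by rewrite /eval_word big_tnth.
exact: eqxx.
Qed.

Lemma gr_finite_dimensional_stationary : finite_dimensional A -> stationary V.
Proof.
move=> [t tP]; have [n nP] : exists n, forall x, x \in t -> x n = 0.
  have [n nP] : exists n, forall x, x \in t -> forall i, (n <= i)%N -> x i = 0.
    elim: {tP}t => [|x t [n nP]]; first by exists 0%N.
    have [m xm] := gr_finite x; exists (maxn m n) => y.
    rewrite inE => /predU1P[->|yt] i; rewrite geq_max => /andP[mi ni]; first exact: xm.
    exact: nP.
  by exists n => x /nP; apply.
apply: (@gr_proj_stationary _ _ _ n) => x; apply: gr_proj_comp.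
have : x \in Defs.span [in t] by rewrite -tP.
apply: (span_subspace (S := fun x : A => x n = 0)) => //.
split=> [//|y z y0 z0|c y y0]; first by rewrite /= /gr_add /= y0 z0 addr0.
by rewrite /= /gr_scale /= y0 scaler0.
Qed.

Lemma finite_dimensional_stationary : finite_dimensional R -> stationary V.
Proof.
move=> R_fin; have [|i x|n nP] := @ascending_chain_stable _ _ R_fin (fun i x => x \in power V i).
- by move=> i; exact: submod_subspace.
- exact: (power_subset V_1 (leqnSn i)).
by exists n.+1; exact: nP.
Qed.

Hypothesis R_alg : algebraic R.

(** A nonempty word has positive degree, so its class is nilpotent and [nil_words_nilpotent] applies
    to the classes of the generators. *)
Lemma satisfies_pi_stationary : satisfies_pi A -> stationary V.
Proof.
move=> /satisfies_pi_multilinear[d [c [c1 c_id]]].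
have [|n nP] := @nil_words_nilpotent _ _ _ (fun i => homog V 1 (g i)) _ _ c1 c_id.
  move=> w w0; rewrite -homog_word; apply: homog_nilpotent => //.
  by rewrite lt0n; apply/eqP => /size0nil.
exists n; apply: (power_words (S := fun a => a \in prev_power V n)).
  exact: submod_subspace.
move=> w wn; apply/homog_eq0; first by rewrite -wn.
by rewrite -wn homog_word nP.
Qed.

Lemma deviation_stationary :
  (forall D (lo hi : A -> Prop), (forall I, D I -> right_ideal I) -> D lo -> D hi ->
     has_deviation D (@incl A) lo hi) ->
  stationary V.
Proof.
move=> dev; suff [n nP] : exists n, forall x : A, gr_proj n x = 0.
  exact: gr_proj_stationary nP.
apply: deviation_proj_eq0 dev.
- exact: gr_projD.
- exact: gr_proj_proj.
- exact: gr_proj_sum.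
- move=> i j x y; have [a Va ->] := gr_projP i x; have [b Vb ->] := gr_projP j y.
  by rewrite homogM // gr_proj_homog eqxx.
- move=> x; have [a /power_scalar[c ->] ->] := gr_projP 0 x.
  rewrite -gr_scalarE => c0; exists c^-1%:A.
  rewrite mulr_algl scalerA mulfV ?scale1r //; apply/eqP => c_eq0.
  by apply: c0; rewrite c_eq0 scale0r.
- move=> i j S S0 SD SM z; have [a Va ->] := gr_projP (i + j)%N z.
  (* [S] is only additive while [power_split] needs a subspace, so all scalar multiples are put into
     the condition. Membership in V^(i+j) is kept because [homog] is meaningful only there. *)
  pose S' a := a \in power V (i + j)%N /\ forall c : k, S (c *: homog V (i + j)%N a).
  suff [_ /(_ 1)] : S' a by rewrite scale1r.
  apply: (@power_split _ _ V i j S' _ _ _ Va) => [|b c Vb Vc].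
    split=> [|b c [Vb Sb] [Vc Sc]|c b [Vb Sb]].
    - by split=> [|c]; rewrite ?rpred0 // homog_zero scaler0.
    - split=> [|d]; first exact: rpredD.
      by rewrite homogD // scalerDr; exact: SD.
    - split=> [|d]; first exact: rpredZ.
      by rewrite homogZ // scalerA.
  split=> [|d]; first exact: powerM.
  rewrite -homogM // scalerAl -homogZ //.
  have := SM (homog V i (d *: b)) (homog V j c).
  by rewrite !gr_proj_homog !eqxx.
- move=> i; exists [seq homog V i x | x <- words i] => I [I0 ID IM] Iw x.
  have : gr_proj i x \in Defs.span [in [seq homog V i x | x <- words i]].
    by apply: homog_words_span => w wn; apply: map_f; exact: mem_words.
  apply: span_subspace.
    split=> // c y Iy; rewrite -[y]mulr1 scalerAr; exact: IM.
  move=> y y_w; have := Iw y y_w; case/mapP: y_w => a _ ->.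
  by rewrite gr_proj_homog eqxx.
- move=> i x i0; have [a Va ->] := gr_projP i x; exact: homog_nilpotent.
Qed.

End Generators.

Theorem theorem2p4 (k : fieldType) (R : algType k) (V : submodClosed R)
    (V_fin : finite_dim V) (V_1 : 1 \in V) (V_gen : generates V)
    (R_alg : algebraic R) :
  [<-> finite_dimensional R;
       finite_dimensional (gr V);
       exists2 n : nat, (0 < n)%N & power (gr_plus (V := V)) n =i pred1 0;
       right_noetherian (gr V);
       has_right_krull_dim (gr V);
       satisfies_pi (gr V)].
Proof.
have [s V_s] := V_fin.
have st_gr := stationary_gr_finite_dimensional V_s.
(* The equivalence unfolds into a cycle of implications, each of which passes through
   [stationary]. *)
split=> [/(finite_dimensional_stationary V_1)/st_gr //|].
split=> [/gr_finite_dimensional_stationary|]; first exact: stationary_nilpotent.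
split=> [[n _ /(nilpotent_stationary V_s)]/st_gr|].
  exact: finite_dimensional_right_noetherian.
split=> [noe|].
  apply: finite_dimensional_right_krull_dim; apply: st_gr.
  apply: (deviation_stationary V_1 V_s R_alg) => D lo hi Dideal Dlo _.
  exact: right_noetherian_has_deviation.
split=> [krull|/(satisfies_pi_stationary V_1 V_s R_alg)].
  apply: stationary_satisfies_pi.
  apply: (deviation_stationary V_1 V_s R_alg) => D lo hi Dideal Dlo Dhi.
  exact: right_krull_has_deviation.
exact: (stationary_finite_dimensional V_1 V_s V_gen).
Qed.
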